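(* There is a deterministic algorithm which, given integers $m,n,a,b$ with $0\le a\le m$, $0\le b\le n$ and $m-a\le 3$, and a subset $E\subseteq[m]\times[n]$, computes the rank of $E$ in the bipartite rigidity matroid $\mathcal{B}_{m,n}(a,b)$ and runs in time polynomial in $m+n$.
   Context: Write $[n]=\{1,\dots,n\}$. For $0\le a\le m$, $0\le b\le n$, the bipartite rigidity matroid $\mathcal{B}_{m,n}(a,b)$ is the matroid on $[m]\times[n]$ given as the column matroid of the following $(an+bm)\times mn$ matrix over $\mathbb{C}(x_{ij},y_{k\ell})_{(i,j)\in[m]\times[a],\,(k,\ell)\in[n]\times[b]}$. Columns are labeled by $[m]\times[n]$; rows are labeled by elements of $[a]\times[n]$ or of $[b]\times[m]$. The row labeled $(j,k)\in[a]\times[n]$ has $x_{ij}$ in the column $(i,k)$ for each $i\in[m]$ and $0$ in every other column. The row labeled $(\ell,i)\in[b]\times[m]$ has $y_{q\ell}$ in the column $(i,q)$ for each $q\in[n]$ and $0$ in every other column. *)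

(* Defs.v *)
From HB Require Import structures.
From mathcomp Require Import all_boot all_order all_algebra.
From mathcomp Require Import fraction mpoly complex reals.

Set Implicit Arguments.
Unset Strict Implicit.
Unset Printing Implicit Defensive.

Import GRing.Theory.
Local Open Scope ring_scope.

(* The set [n] = {1, ..., n} is represented by 'I_n = {0, ..., n - 1}. *)

Section ColumnMatroid.
Variables (K : fieldType) (I J : finType) (M : I -> J -> K).

Definition column_mx (S : {set J}) : 'M[K]_(#|I|, #|S|) :=
  \matrix_(r, c) M (enum_val r) (enum_val c).

(* The columns indexed by S are linearly independent. *)
Definition column_indep (S : {set J}) : bool := row_free (column_mx S)^T.

Definition column_rank (E : {set J}) : nat :=
  (\max_(S : {set J} | (S \subset E) && column_indep S) #|S|)%N.

End ColumnMatroid.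

Section BipartiteRigidity.
Variables (F : fieldType) (m n a b : nat).

(* inl (i, j) stands for x_ij and inr (k, l) for y_kl. *)
Definition indet : finType := ('I_m * 'I_a + 'I_n * 'I_b)%type.

Definition rigidity_field : fieldType := {fraction {mpoly F[#|indet|]}}.

Definition indet_val (v : indet) : rigidity_field :=
  tofrac ('X_(enum_rank v) : {mpoly F[#|indet|]}).

Definition xvar (i : 'I_m) (j : 'I_a) : rigidity_field := indet_val (inl (i, j)).
Definition yvar (k : 'I_n) (l : 'I_b) : rigidity_field := indet_val (inr (k, l)).

Definition rigidity_row : finType := ('I_a * 'I_n + 'I_b * 'I_m)%type.

Definition rigidity_entry (r : rigidity_row) (c : 'I_m * 'I_n) :
    rigidity_field :=
  match r with
  | inl (j, k) => if c.2 == k then xvar c.1 j else 0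
  | inr (l, i) => if c.1 == i then yvar c.2 l else 0
  end.

Definition rigidity_rank (E : {set 'I_m * 'I_n}) : nat :=
  column_rank rigidity_entry E.

End BipartiteRigidity.

(* Algorithms are programs of the random access machine of Cook and Reckhow,
   with registers holding natural numbers and unit cost per instruction.  There
   is no multiplication, so register contents gain at most one bit per step and
   running times are polynomially related to those of Turing machines. *)
Inductive instr :=
| Const of nat & nat        (* Const i c   : X_i := c *)
| Add of nat & nat & nat    (* Add i j k   : X_i := X_j + X_k *)
| Sub of nat & nat & nat    (* Sub i j k   : X_i := X_j - X_k, truncated at 0 *)
| Fetch of nat & nat        (* Fetch i j   : X_i := X_(X_j) *)
| Store of nat & nat        (* Store i j   : X_(X_i) := X_j *)
| JumpPos of nat & nat.     (* JumpPos i l : go to instruction l if X_i > 0 *)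

Definition program := seq instr.
Definition memory := nat -> nat.

Record config := Config { pc : nat; mem : memory }.

Definition upd (s : memory) (i v : nat) : memory :=
  fun j => if j == i then v else s j.

Definition exec (c : instr) (st : config) : config :=
  let: Config p s := st in
  match c with
  | Const i v => Config p.+1 (upd s i v)
  | Add i j k => Config p.+1 (upd s i (s j + s k)%N)
  | Sub i j k => Config p.+1 (upd s i (s j - s k)%N)
  | Fetch i j => Config p.+1 (upd s i (s (s j)))
  | Store i j => Config p.+1 (upd s (s i) (s j))
  | JumpPos i l => Config (if (0 < s i)%N then l else p.+1) s
  end.

(* The machine halts when the program counter leaves the program. *)
Definition halted (P : program) (st : config) : bool := (size P <= pc st)%N.

Definition step (P : program) (st : config) : config :=
  if onth P (pc st) is Some c then exec c st else st.

(* The input is stored in the first registers and the others contain 0; the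
   output is read from register 0.  A halted configuration is a fixed point of
   step, so this says that P halts after at most t instructions. *)
Definition computes_within (P : program) (input : seq nat) (out t : nat) : Prop :=
  let st := iter t (step P) (Config 0 (nth 0%N input)) in
  halted P st /\ mem st 0 = out.

(* m, n, a, b, followed by the m x n incidence matrix of E in row-major order. *)
Definition encode_input (m n a b : nat) (E : {set 'I_m * 'I_n}) : seq nat :=
  [:: m; n; a; b] ++
  [seq nat_of_bool ((i, j) \in E) | i <- enum 'I_m, j <- enum 'I_n].

(* Main.v *)
(** Adding empty rows to [E] does not change its rank, so assume [m = a + 3].
    The rank of [E] is [#|E|] minus the dimension of the space of the matrices
    [M] supported on [E] with [x^T M = 0] and [M y = 0].  Column [q] of such an
    [M] lies in [V_q], the subspace of the 3-dimensional space [ker x^T] cut out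
    by the vanishing of the coordinates [i] with [(i, q)] not in [E]; counting
    dimensions, the nullity is at least [sum_q dim (V_q :&: W) - b * dim W] for
    every subspace [W] of [ker x^T].

    For a suitable [y] one [W] gives equality.  Let [D] be the space of the
    matrices with columns in the [V_q], and let [y] maximise [dim (D y)].  If
    [M y = 0] with [M] in [D], then [M y'] is in [D y] for all [y'], as
    otherwise [dim (D (y + t y')) > dim (D y)] for some [t].  Hence, with [W] the
    span of the columns of all the null [M], every matrix with columns in [W]
    lies in [D y].  If [W] has dimension 0 or 3 this is enough; since any
    family of rows of a generic [y] is independent or spanning, the lines [W]
    and the lines [ker x^T / W] are easily handled.  This exhausts all cases.

    For [ker x^T] made of the values of quadratic polynomials at generic points
    [t_i], only polynomially many [W] are relevant.  The resulting formula for
    the rank uses only additions, truncated subtractions and bounded sums; such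
    expressions are compiled to the random access machine. *)
Require Import Defs.
From mathcomp Require Import all_boot all_order all_algebra.
From mathcomp Require Import complex reals.
From mathcomp Require Import fraction mpoly boolp zify ring.

Set Implicit Arguments.
Unset Strict Implicit.
Unset Printing Implicit Defensive.

Import GRing.Theory.
Local Open Scope ring_scope.

(** * Matrices with prescribed zeros *)

Section Subspaces.
Variables (F : fieldType) (vT : vectType F).
Implicit Types U V W : {vspace vT}.

Lemma exists_subv_dim U V k :
  (U <= V)%VS -> (\dim U <= k <= \dim V)%N ->
  exists W : {vspace vT}, [/\ (U <= W)%VS, (W <= V)%VS & \dim W = k].
Proof.
move=> UV /andP[Uk kV]; elim: k Uk kV => [|k IHk] Uk kV.
  by exists U; split=> //; apply/eqP; rewrite -leqn0.
move: Uk; rewrite leq_eqVlt => /predU1P[<-|Uk]; first by exists U.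
have [W [UW WV dW]] := IHk Uk (ltnW kV).
have /subvPn[v vV vW] : ~~ (V <= W)%VS.
  by apply: contraL kV => /dimvS; rewrite dW -leqNgt.
exists (W + <[v]>)%VS; split.
- exact: subv_trans UW (addvSl _ _).
- by rewrite subv_add WV.
- have v0 : v != 0 by apply: contraNneq vW => ->; rewrite mem0v.
  rewrite dimv_disjoint_sum ?dW ?dim_vline ?v0 ?addn1 //; apply/eqP.
  rewrite -subv0; apply/subvP => w /memv_capP[wW /vlineP[c wc]].
  rewrite memv0 wc; have [->|c0] := eqVneq c 0; first by rewrite scale0r.
  by move: wW; rewrite wc rpredZeq (negPf c0) (negPf vW).
Qed.

End Subspaces.

Lemma dim_mx (F : fieldType) (p q : nat) : dim 'M[F]_(p, q) = (p * q)%N.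
Proof. exact: dim_matrix. Qed.

Section ColumnSpaces.
Variables (F : fieldType) (N n : nat).
Implicit Types (W : {vspace 'cV[F]_N}) (T : 'I_n -> {vspace 'cV[F]_N}).
Implicit Types (C : {set 'I_N}) (M : 'M[F]_(N, n)).

Definition colemb (q : 'I_n) : 'Hom('cV[F]_N, 'M[F]_(N, n)) :=
  linfun (mulmxr (delta_mx 0 q : 'rV[F]_n)).

Lemma colembE q z : colemb q z = z *m delta_mx 0 q.
Proof. by rewrite lfunE. Qed.

Lemma col_colemb p q z : col p (colemb q z) = (p == q)%:R *: z.
Proof.
apply/colP => i; rewrite colembE !mxE big_ord1 !mxE eqxx /=.
by rewrite mulrC.
Qed.

Lemma sum_colemb (v : 'I_n -> 'cV[F]_N) p :
  col p (\sum_q colemb q (v q)) = v p.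
Proof.
rewrite linear_sum /= (bigD1 p) //= col_colemb eqxx scale1r big1 ?addr0 //.
by move=> q qp; rewrite col_colemb eq_sym (negPf qp) scale0r.
Qed.

Lemma mx_sum_col M : M = \sum_q colemb q (col q M).
Proof. by apply/matrixP => i p; have /colP/(_ i) := sum_colemb (fun q => col q M) p;
  rewrite !mxE. Qed.

Definition colspace T : {vspace 'M[F]_(N, n)} := (\sum_q (colemb q @: T q))%VS.

Lemma mem_colspace T M :
  reflect (forall q, col q M \in T q) (M \in colspace T).
Proof.
apply: (iffP memv_sumP) => [[vs Tvs ->] p|MT].
  have vsE q : exists2 z, z \in T q & vs q = colemb q z.
    by apply/memv_imgP/Tvs.
  rewrite linear_sum /= rpred_sum // => q _.
  have [z zT ->] := vsE q; rewrite col_colemb; case: eqP => [->|_].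
    by rewrite scale1r.
  by rewrite scale0r mem0v.
exists (fun q => colemb q (col q M)); last exact: mx_sum_col.
by move=> q _; apply: memv_img.
Qed.

Lemma dim_colspace T : \dim (colspace T) = (\sum_q \dim (T q))%N.
Proof.
have -> : \dim (colspace T) = (\sum_q \dim (colemb q @: T q))%N.
  apply/eqP; apply/directv_sum_independent => us Tus us0 q _.
  have usE p : us p = colemb p (col p (us p)).
    have /memv_imgP[z _ ->] := Tus p isT.
    by rewrite col_colemb eqxx scale1r.
  have : col q (\sum_i us i) = 0 by rewrite us0 linear0.
  under eq_bigr => i _ do rewrite usE.
  by rewrite sum_colemb => c0; rewrite usE c0 linear0.
apply: eq_bigr => q _; apply: limg_dim_eq; apply/eqP; rewrite -subv0.
apply/subvP => z; rewrite memv_cap memv_ker memv0 => /andP[_ /eqP z0].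
by rewrite -[z]scale1r; have := col_colemb q q z; rewrite z0 eqxx linear0 => <-.
Qed.

Definition zeros C : {vspace 'cV[F]_N} :=
  (\bigcap_(i in C) lker (linfun (row i)))%VS.

Lemma mem_zeros C (z : 'cV[F]_N) : reflect (forall i, i \in C -> z i 0 =
  0) (z \in zeros C).
Proof.
apply: (iffP subv_bigcapP) => zC i iC.
  by have := zC i iC; rewrite -memvE memv_ker lfunE /= => /eqP/rowP/(_ 0); rewrite !mxE.
by rewrite -memvE memv_ker lfunE /=; apply/eqP/rowP => j; rewrite !mxE ord1 zC.
Qed.

Lemma zerosU C C' : zeros (C :|: C') = (zeros C :&: zeros C')%VS.
Proof.
apply/eqP; rewrite eqEsubv; apply/andP; split; apply/subvP => z.
  move/mem_zeros=> zC; rewrite memv_cap.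
  by apply/andP; split; apply/mem_zeros => i iC; rewrite zC // inE iC ?orbT.
rewrite memv_cap => /andP[/mem_zeros zC /mem_zeros zC']; apply/mem_zeros => i.
by case/setUP; auto.
Qed.

(** Each coordinate is one linear form, and a linear form cuts the dimension by at most one. *)
Lemma dim_cap_zeros W C : (\dim W - #|C| <= \dim (W :&: zeros C))%N.
Proof.
rewrite /zeros -big_enum cardE; elim: (enum C) => [|i s IHs].
  by rewrite big_nil capvf subn0.
rewrite big_cons /= [X in (W :&: X)%VS]capvC capvA.
set U := (W :&: _)%VS in IHs *.
have E := limg_ker_dim (linfun (row i)) U.
have le1 : (\dim (linfun (row i : 'cV[F]_N -> _) @: U) <= 1)%N.
  by apply: leq_trans (dimvS (subvf _)) _; rewrite dimvf dim_mx.
apply: leq_trans (_ : _ <= \dim U - 1)%N _; first by rewrite /= subnS -subn1 leq_sub2r.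
by rewrite -E leq_subLR [X in (_ <= X)%N]addnC leq_add2l.
Qed.

End ColumnSpaces.

Arguments colemb {F N n} q.
Arguments zeros {F N} C.

(* Lower bounds for the dimension of the space of matrices vanishing on C_q in
   column q and killed by x^T and y; they come from the subspaces W of ker x^T
   of the form: a 3-space, a plane in z_i = 0, a line in z_i = z_j = 0, a plane
   containing a vector of z_i = z_j = 0 and a vector of z_k = z_l = 0. *)
Definition null_bound (N n b : nat) (C : 'I_n -> {set 'I_N}) (i j k l : 'I_N) :=
  let d S q := #|C q :\: S| in
  [:: \sum_q (3 - d set0 q) - 3 * b;
      \sum_q (2 - d [set i] q) - 2 * b;
      \sum_q (1 - d [set i; j] q) - b;
      \sum_q maxn (2 - d set0 q)
                  (maxn (1 - d [set i; j] q) (1 - d [set k; l] q)) - 2 * b]%N.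

Section NullSpace.
Variables (F : fieldType) (N n a b : nat).
Variables (x : 'M[F]_(N, a)) (y : 'M[F]_(n, b)) (C : 'I_n -> {set 'I_N}).
Implicit Types W : {vspace 'cV[F]_N}.

Definition orth : {vspace 'cV[F]_N} := lker (linfun (mulmx x^T)).

Lemma mem_orth z : (z \in orth) = (x^T *m z == 0).
Proof. by rewrite memv_ker lfunE. Qed.

Lemma dim_orth : (N - a <= \dim orth)%N.
Proof.
have E := limg_ker_dim (linfun (mulmx x^T : 'cV[F]_N -> 'cV[F]_a)) fullv.
have leA : (\dim (linfun (mulmx x^T : 'cV[F]_N -> 'cV[F]_a) @: fullv) <= a)%N.
  by apply: leq_trans (dimvS (subvf _)) _; rewrite dimvf dim_mx muln1.
move: E; rewrite capfv dimvf dim_mx muln1 => E.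
by rewrite -[X in (X - _)%N]E leq_subLR [X in (_ <= X)%N]addnC leq_add2l.
Qed.

Definition rmul : 'Hom('M[F]_(N, n), 'M[F]_(N, b)) := linfun (mulmxr y).

Lemma rmulE M : rmul M = M *m y. Proof. by rewrite lfunE. Qed.

Definition solsp := colspace (fun q => orth :&: zeros (C q))%VS.

(** When [C] is the complement of an edge set, these matrices are the linear relations between the
    corresponding columns of the rigidity matrix; see [mem_nullsp_mxof]. *)
Definition nullsp : {vspace 'M[F]_(N, n)} := (solsp :&: lker rmul)%VS.

(** The columns of [M *m y] are linear combinations of those of [M], so the image consists of
    matrices with [b] columns in [W]. *)
Lemma dim_rmul W (T : 'I_n -> {vspace 'cV[F]_N}) :
  (forall q, (T q <= W)%VS) -> (\dim (rmul @: colspace T) <= b * \dim W)%N.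
Proof.
move=> TW; have -> : (b * \dim W = \dim (colspace (fun=> W) : {vspace 'M[F]_(N, b)}))%N.
  by rewrite dim_colspace sum_nat_const card_ord.
apply/dimvS/subvP => _ /memv_imgP[M /mem_colspace MT ->].
apply/mem_colspace => l; rewrite rmulE [M]mx_sum_col mulmx_suml linear_sum /=.
apply: rpred_sum => q _; have -> : col l (colemb q (col q M) *m y) = y q l *: col q M.
  apply/colP => i; rewrite !mxE (bigD1 q) //= big1 ?addr0.
    by have /colP/(_ i) := col_colemb q q (col q M); rewrite eqxx scale1r !mxE mulrC =>
      ->.
  move=> p pq; have /colP/(_ i) := col_colemb p q (col q M).
  by rewrite (negPf pq) scale0r !mxE => ->; rewrite mul0r.
exact/memvZ/(subvP (TW q)).
Qed.

(** Rank-nullity for [M |-> M *m y] on the matrices whose column [q] lies in [W :&: zeros (C q)]: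
    the kernel is part of [nullsp], and [dim_rmul] bounds the image. *)
Lemma nullsp_lower W : (W <= orth)%VS ->
  (\sum_q \dim (W :&: zeros (C q)) - b * \dim W <= \dim nullsp)%N.
Proof.
move=> WO; pose T q := (W :&: zeros (C q))%VS.
have TW q : (T q <= W)%VS by apply: capvSl.
rewrite -(dim_colspace T) -(limg_ker_dim rmul (colspace T)).
rewrite leq_subLR addnC; apply: leq_add; first exact: dim_rmul.
apply/dimvS/capvS => //; apply/subvP => M /mem_colspace MT.
by apply/mem_colspace => q; apply: subvP (MT q); apply: capvS.
Qed.

Hypothesis orth3 : (3 <= \dim orth)%N.

(** The coordinates in [S] already vanish on [W], so only those in [A :\: S] impose conditions. *)
Lemma dim_cap_zerosD W (S A : {set 'I_N}) : (W <= zeros S)%VS ->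
  (\dim W - #|A :\: S| <= \dim (W :&: zeros A))%N.
Proof.
move=> WS; apply: leq_trans (dim_cap_zeros W (A :\: S)) _.
apply/dimvS/subvP => z /memv_capP[zW /mem_zeros zAS].
rewrite memv_cap zW; apply/mem_zeros => i iA; have [iS|iS] := boolP (i \in S).
  by move/subvP/(_ z zW)/mem_zeros: WS; apply.
by rewrite zAS // inE iS.
Qed.

(** [orth :&: zeros S] has dimension at least [3 - #|S|], which leaves room for a subspace of
    dimension [k]. *)
Lemma exists_orth_subv (S : {set 'I_N}) k : (k + #|S| <= 3)%N ->
  exists W, [/\ (W <= orth)%VS, (W <= zeros S)%VS & \dim W = k].
Proof.
move=> kS; have [||W [_ WO dW]] := @exists_subv_dim _ _ 0%VS (orth :&: zeros S)%VS k.
- exact: sub0v.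
- by rewrite dimv0 /=; have := dim_cap_zeros orth S; lia.
- by exists W; move: WO; rewrite subv_cap => /andP[].
Qed.

Lemma null_bound_lower i j k l c :
  c \in null_bound b C i j k l -> (c <= \dim nullsp)%N.
Proof.
have step (S : {set 'I_N}) r : (r + #|S| <= 3)%N ->
    (\sum_q (r - #|C q :\: S|) - r * b <= \dim nullsp)%N.
  move=> /exists_orth_subv[W [WO WS dW]]; apply: leq_trans (nullsp_lower WO).
  by rewrite dW mulnC leq_sub2r // leq_sum // => q _; rewrite -dW dim_cap_zerosD.
have c2 (u v : 'I_N) : (#|[set u; v]| <= 2)%N by rewrite cards2; case: (u != v).
rewrite !inE => /or4P[] /eqP->.
- by apply: step; rewrite cards0.
- by apply: step; rewrite cards1.
- by rewrite -[X in (_ - X)%N]mul1n; apply: step; rewrite ltnS c2.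
have [|L [LO LS dL]] := @exists_orth_subv [set i; j] 1; first by rewrite ltnS c2.
have [|L' [LO' LS' dL']] := @exists_orth_subv [set k; l] 1; first by rewrite ltnS c2.
(* The lines [L] and [L'] may coincide, so their sum is enlarged to a plane when necessary. *)
have [||W [LW WO dW]] := @exists_subv_dim _ _ (L + L')%VS orth 2.
- by rewrite subv_add LO LO'.
- by rewrite (ltnW orth3) andbT; apply: leq_trans (dimv_add_leqif L L') _;
  rewrite dL dL'.
apply: leq_trans (nullsp_lower WO).
rewrite dW mulnC leq_sub2r // leq_sum // => q _; rewrite !geq_max.
move: LW; rewrite subv_add => /andP[LW LW']; apply/and3P; split.
- by rewrite -dW dim_cap_zerosD //; apply/subvP => z _; apply/mem_zeros => u;
  rewrite inE.
- rewrite -[X in (X - _ <= _)%N]dL; apply: leq_trans (dim_cap_zerosD _ LS) _.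
  exact/dimvS/capvS.
- rewrite -[X in (X - _ <= _)%N]dL'; apply: leq_trans (dim_cap_zerosD _ LS') _.
  exact/dimvS/capvS.
Qed.

End NullSpace.

(** * Subspaces attaining the nullity for generic y *)

Section Perturbation.
Variables (F : fieldType).

Variables (aT rT : vectType F).
Implicit Types (f g : 'Hom(aT, rT)) (U : {vspace aT}).

(** The determinant of the polynomial matrix [1 + 'X A] has value 1 at 0, so it is not the zero
    polynomial. *)
Lemma det_perturb k (A : 'M[F]_k) :
  exists2 h : {poly F}, h != 0 & forall t, h.[t] = \det (1%:M + t *: A).
Proof.
pose h : {poly F} := \det (map_mx polyC 1%:M + 'X *: map_mx polyC A).
have hE t : h.[t] = \det (1%:M + t *: A).
  rewrite -horner_evalE -det_map_mx; congr (\det _).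
  by apply/matrixP => i j; rewrite !mxE /= horner_evalE !hornerE.
exists h => //; apply: contraTneq isT => h0.
by have := hE 0; rewrite h0 horner0 scale0r addr0 det1 => /esym/eqP; rewrite oner_eq0.
Qed.

(** The coordinate forms of [X] send the family [X + t Y] to the rows of [1 + t A]; the family is
    free as soon as this matrix is invertible. *)
Lemma free_perturb k (X Y : k.-tuple rT) : free X ->
  exists2 h : {poly F}, h != 0 &
    forall t, h.[t] != 0 -> free [tuple X`_i + t *: Y`_i | i < k].
Proof.
move=> Xfree; pose A := \matrix_(i < k, j < k) coord X j Y`_i.
have [h h0 hE] := det_perturb A; exists h => // t; rewrite hE => nz.
apply/freeP => c c0 i.
suff /rowP/(_ i) : \row_i c i = 0 by rewrite !mxE.
apply: (can_inj (mulmxK (_ : 1%:M + t *: A \in unitmx))).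
  by rewrite unitmxE unitfE.
apply/rowP => j; rewrite mul0mx [RHS]mxE -(linear0 (coord X j)) -[in RHS]c0.
rewrite linear_sum mxE; apply: eq_bigr => l _.
by rewrite -tnth_nth tnth_mktuple linearZ linearD linearZ /= coord_free // !mxE.
Qed.

Lemma dim_perturb k (X Y : k.-tuple rT) (V : F -> {vspace rT}) :
    free X -> (forall t i, t != 0 -> (i < k)%N -> X`_i + t *: Y`_i \in V t) ->
  exists2 h : {poly F}, h != 0 & forall t, h.[t] != 0 -> (k <= \dim (V t))%N.
Proof.
move=> Xfree XYV; have [h h0 hP] := free_perturb Y Xfree.
(* The factor ['X] excludes [t = 0], where the family need not lie in [V t]. *)
exists (h * 'X) => [|t]; first by rewrite mulf_neq0 // polyX_eq0.
rewrite hornerM hornerX mulf_eq0 negb_or => /andP[/hP fr t0].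
move: fr; rewrite /free => /eqP; rewrite size_tuple => <-.
by apply/dimvS/span_subvP => _ /tnthP[i ->]; rewrite tnth_mktuple XYV.
Qed.

Lemma img_basis f U : exists B : (\dim (f @: U)).-tuple aT,
  {subset B <= U} /\ basis_of (f @: U) (map f B).
Proof.
have fB := limg_basis_of (capv_diff U (lker f)) (vbasisP _).
rewrite limg_ker_compl in fB.
have szB : size (vbasis (U :\: lker f)) == \dim (f @: U)%VS.
  by rewrite size_tuple (vector.size_basis fB).
exists (Tuple szB); split=> // v /vbasis_mem; exact/subvP/diffvSl.
Qed.

(** Semicontinuity of the rank: a basis of [f @: U] stays free for all but finitely many [t]. *)
Lemma dim_img_perturb f g U : exists2 h : {poly F}, h != 0 &
  forall t, h.[t] != 0 -> (\dim (f @: U) <= \dim ((f + t *: g) @: U))%N.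
Proof.
have [B [BU /basis_free fB]] := img_basis f U.
apply: (@dim_perturb _ (map_tuple f B) (map_tuple g B)) => // t i _ ik.
rewrite !(nth_map 0) ?size_tuple // -scale_lfunE -add_lfunE memv_img //.
by rewrite BU // mem_nth ?size_tuple.
Qed.

(** For [t != 0] the vector [g w] is the image of [t^-1 *: w] under [f + t *: g]. Joined to the
    perturbed basis of [f @: U], it adds one dimension. *)
Lemma dim_img_perturb_lt f g U w : w \in U -> f w = 0 -> g w \notin (f @: U)%VS ->
  exists2 h : {poly F}, h != 0 &
  forall t, h.[t] != 0 -> (\dim (f @: U) < \dim ((f + t *: g) @: U))%N.
Proof.
move=> wU fw0 gw; have [B [BU fB]] := img_basis f U.
apply: (@dim_perturb _ [tuple of g w :: map f B] [tuple of 0 :: map g B]).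
  by rewrite /= free_cons (span_basis fB) gw (basis_free fB).
move=> t [|i] /= t0 ik.
  rewrite scaler0 addr0; apply/memv_imgP; exists (t^-1 *: w); first exact: memvZ.
  by rewrite linearZ /= add_lfunE scale_lfunE fw0 add0r scalerA mulVf // scale1r.
rewrite !(nth_map 0) ?size_tuple // -scale_lfunE -add_lfunE memv_img //.
by rewrite BU // mem_nth ?size_tuple.
Qed.

End Perturbation.

Arguments rmul {F N n b} y.

Section Tangent.
Variables (F : fieldType) (N n b : nat).
Hypothesis F_infinite : forall p : {poly F}, p != 0 -> exists t, p.[t] != 0.

(** A [y] maximising the sum [Phi] of the ranks over the family works for all [i] at once: a
    violation at one [i] would allow a move to [y + t *: y'] that raises the rank on [U i] and
    lowers no other. *)
Lemma exists_tangent (I : finType) (U : I -> {vspace 'M[F]_(N, n)}) :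
  exists y : 'M[F]_(n, b), forall i M (y' : 'M[F]_(n, b)),
    M \in U i -> M *m y = 0 -> M *m y' \in (rmul y @: U i)%VS.
Proof.
pose tangent (y : 'M[F]_(n, b)) := forall i M (y' : 'M[F]_(n, b)),
  M \in U i -> M *m y = 0 -> M *m y' \in (rmul y @: U i)%VS.
pose Phi (y : 'M[F]_(n, b)) := (\sum_i \dim (rmul y @: U i))%N.
have PhiB y : (Phi y <= \sum_i \dim (U i))%N.
  by apply: leq_sum => i _; rewrite -(limg_ker_dim (rmul y) (U i)) leq_addl.
have incr y : ~ tangent y -> exists y', (Phi y < Phi y')%N.
  move=> NT; apply: contrapT => maxy; apply: NT => i M y' MU My0.
  apply: contrapT => /negP My'; apply: maxy.
  have [] := @dim_img_perturb_lt _ _ _ (rmul y) (rmul y') (U i) M; rewrite ?rmulE //.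
  move=> h0 h0nz h0P.
  have [h hnz hP] := fin_all_exists2 (fun j => dim_img_perturb (rmul y) (rmul y')
    (U j)).
  have [|t] := F_infinite (p := h0 * \prod_j h j).
    by rewrite mulf_neq0 //; apply/prodf_neq0 => j _; apply: hnz.
  rewrite hornerM horner_prod mulf_eq0 negb_or => /andP[h0t /prodf_neq0 ht].
  have yE : rmul (y + t *: y') = rmul y + t *: rmul y' :> 'Hom('M[F]_(N, n), _).
    by apply/lfunP => z; rewrite add_lfunE scale_lfunE !rmulE mulmxDr scalemxAr.
  exists (y + t *: y'); rewrite /Phi (bigD1 i) //= [ltnRHS](bigD1 i) //= yE -addSn.
  by apply: leq_add; [exact: h0P | apply: leq_sum => j _; apply: hP; apply: ht].
(* [PhiB] bounds [Phi], so it can be increased only finitely often; [k] bounds the number of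
   remaining increases. *)
suff H k y : (\sum_i \dim (U i) <= Phi y + k)%N -> exists y, tangent y.
  by apply: (H (\sum_i \dim (U i))%N 0); rewrite leq_addl.
elim: k y => [|k IHk] y leS; apply: contrapT => NT.
  by have [y' lt] := incr y (fun T => NT (ex_intro _ y T)); have := PhiB y'; lia.
have [y' lt] := incr y (fun T => NT (ex_intro _ y T)).
by apply: NT; apply: (IHk y'); lia.
Qed.

End Tangent.

Arguments orth {F N a} x.
Arguments colspace {F N n} T.
Arguments solsp {F N n a} x C.

Lemma col_outer (F : fieldType) N p (v : 'cV[F]_N) (u : 'rV_p) q :
  col q (v *m u) = u 0 q *: v.
Proof. by apply/colP => i; rewrite !mxE big_ord1 mulrC. Qed.

Section NullSpaceUpper.
Variables (F : fieldType) (N n a b : nat).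
Hypothesis F_infinite : forall p : {poly F}, p != 0 -> exists t, p.[t] != 0.
Variables (x : 'M[F]_(N, a)) (C : 'I_n -> {set 'I_N}).
Implicit Types W : {vspace 'cV[F]_N}.

(** Rank-nullity again: the kernel of [rmul y] on this space contains [nullsp], and its image
    contains every matrix with columns in [W]. *)
Lemma nullsp_upper (y : 'M[F]_(n, b)) W :
    (nullsp x y C <= colspace (fun q => W :&: zeros (C q)))%VS ->
    (forall w (c : 'rV_b), w \in W ->
      w *m c \in (rmul y @: colspace (fun q => W :&: zeros (C q)))%VS) ->
  (\dim (nullsp x y C) + b * \dim W <= \sum_q \dim (W :&: zeros (C q)))%N.
Proof.
set D := colspace _ => ND Wim; rewrite -dim_colspace -/D.
have -> : (b * \dim W = \dim (colspace (fun=> W) : {vspace 'M[F]_(N, b)}))%N.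
  by rewrite dim_colspace sum_nat_const card_ord.
rewrite -(limg_ker_dim (rmul y) D); apply: leq_add; apply: dimvS.
  by rewrite subv_cap ND capvSr.
apply/subvP => M /mem_colspace MW; rewrite [M]mx_sum_col rpred_sum // => l _.
by rewrite colembE Wim.
Qed.

(** With [W1] the span of the columns of all null matrices, [W] is either [W1] or the whole of
    [orth x], depending on [\dim W1] and on whether certain rows of [y] are independent or
    spanning. *)
Lemma exists_nullsp_eq : (0 < N)%N -> \dim (orth x) = 3 -> exists (y : 'M[F]_(n, b)) W,
  (W <= orth x)%VS /\
  (\dim (nullsp x y C) + b * \dim W <= \sum_q \dim (W :&: zeros (C q)))%N.
Proof.
move=> N0 dO; pose r0 := Ordinal N0.
(* [None] stands for the space in which the nullity is computed, [Some S'] for the row vectors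
   supported on [S'], placed in row [r0]. One [y] serves all of them. *)
pose U (S : option {set 'I_n}) : {vspace 'M[F]_(N, n)} :=
  if S is Some S' then colspace (fun q => if q \in S' then zeros (~: [set r0]) else
    0%VS)
  else solsp x C.
have [y yU] := exists_tangent b F_infinite U.
(* The rows of y indexed by S are independent or span. *)
have dich (S : {set 'I_n}) :
    (forall u : 'rV_n, (forall q, q \notin S -> u 0 q = 0) -> u *m y = 0 -> u = 0) \/
    (forall c : 'rV_b, exists u : 'rV_n, (forall q, q \notin S -> u 0 q = 0) /\ u *m y
      = c).
  have [?|] := pselect (forall u : 'rV_n, (forall q, q \notin S -> u 0 q = 0) ->
    u *m y = 0 -> u = 0); first by left.
  move=> /existsNP[u /not_implyP[uS /not_implyP[uy u0]]]; right=> c.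
  have [p up] : exists p, u 0 p != 0.
    apply: contrapT => /forallNP up; apply: u0; apply/rowP => p; rewrite mxE.
    by apply: contrapT => /eqP; apply: up.
  pose M : 'M[F]_(N, n) := delta_mx r0 0 *m u.
  have ME q : col q M = u 0 q *: delta_mx r0 0.
    by apply/colP => i; rewrite !mxE big_ord1 !mxE mulrC.
  have MU : M \in U (Some S).
    apply/mem_colspace => q; rewrite ME; case: ifP => [qS|/negbT/uS->].
      apply: memvZ; apply/mem_zeros => i; rewrite !inE => i0.
      by rewrite mxE (negPf i0).
    by rewrite scale0r mem0v.
  (* This [y'] satisfies [u *m y' = c], so the tangency of [y] at [M] writes [c] as a combination of
     the rows of [y] in [S]. *)
  have := yU (Some S) M (delta_mx p 0 *m ((u 0 p)^-1 *: c)) MU.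
  rewrite -mulmxA uy mulmx0 => /(_ erefl) /memv_imgP[M' /mem_colspace M'U].
  rewrite rmulE => /(congr1 (row r0)); rewrite !row_mul.
  rewrite mulmxA -colE => eqc; exists (row r0 M'); split=> [q qS|].
    have := M'U q; rewrite (negPf qS) memv0 => /eqP/colP/(_ r0).
    by rewrite !mxE.
  rewrite -eqc; have -> : row r0 (delta_mx r0 0 : 'cV[F]_N) = 1%:M.
    by apply/rowP => l; rewrite !mxE eqxx ord1.
  by rewrite mul1mx -scalemxAr; apply/rowP => l; rewrite !mxE big_ord1 !mxE mulKf.
set Nl := nullsp x y C.
pose W1 : {vspace 'cV[F]_N} := (\sum_q (linfun (col q) @: Nl))%VS.
have NlP M : M \in Nl -> (forall q, col q M \in (orth x :&: zeros (C q))%VS) /\ M *m y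
  = 0.
  by rewrite memv_cap memv_ker rmulE => /andP[/mem_colspace ? /eqP].
have colW1 M q : M \in Nl -> col q M \in W1.
  move=> MN; apply: (subvP (sumv_sup q isT (subvv _))).
  by rewrite -[col q M]/(col q M) -(lfunE (col q)) memv_img.
have W1O : (W1 <= orth x)%VS.
  apply/subv_sumP => q _; apply/subvP => _ /memv_imgP[M /NlP[MO _] ->].
  by rewrite lfunE; have := MO q; rewrite memv_cap => /andP[].
(* For a null [M], the product [col q M *m c] is [M] times a matrix whose only nonzero row is [c];
   the choice of [y] puts it into the image. *)
have W1im w (c : 'rV_b) : w \in W1 -> w *m c \in (rmul y @: solsp x C)%VS.
  case/memv_sumP => vs vsP ->; rewrite mulmx_suml rpred_sum // => q _.
  have /memv_imgP[M MN ->] := vsP q isT; have [MO My] := NlP M MN.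
  rewrite lfunE /= colE -mulmxA; apply: (yU None) => //.
  exact/mem_colspace.
have ND W : (W1 <= W)%VS -> (Nl <= colspace (fun q => W :&: zeros (C q)))%VS.
  move=> W1W; apply/subvP => M MN; apply/mem_colspace => q.
  have [MO _] := NlP M MN; have := MO q; rewrite !memv_cap => /andP[_ ->].
  by rewrite andbT (subvP W1W) // colW1.
have concl W : (W1 <= W)%VS -> (W <= orth x)%VS ->
    (forall w (c : 'rV_b), w \in W ->
      w *m c \in (rmul y @: colspace (fun q => W :&: zeros (C q)))%VS) ->
    exists (y : 'M[F]_(n, b)) W, (W <= orth x)%VS /\
      (\dim (nullsp x y C) + b * \dim W <= \sum_q \dim (W :&: zeros (C q)))%N.
  move=> W1W WO Wim; exists y, W; split=> //; apply: nullsp_upper => //.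
  exact: ND.
have concl3 : (forall w (c : 'rV_b), w \in orth x -> w *m c \in (rmul y @:
  solsp x C)%VS) ->
    exists (y : 'M[F]_(n, b)) W, (W <= orth x)%VS /\
      (\dim (nullsp x y C) + b * \dim W <= \sum_q \dim (W :&: zeros (C q)))%N.
  by move=> H; apply: (concl (orth x)).
have := dimvS W1O; rewrite dO leq_eqVlt => /predU1P[d3|].
  apply: concl3 => w c; have -> : orth x = W1 by apply/eqP;
    rewrite eq_sym eqEdim W1O d3 dO.
  exact: W1im.
rewrite ltnS leq_eqVlt => /predU1P[d2|].
  have /subvPn[v vO vW] : ~~ (orth x <= W1)%VS.
    by apply/negP => /dimvS; rewrite dO d2.
  have OE : orth x = (W1 + <[v]>)%VS.
    apply/eqP; rewrite eq_sym eqEdim subv_add W1O -memvE vO dO ltnNge /= -d2.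
    apply: contra vW => le; have := dimv_leqif_sup (addvSl W1 <[v]>%VS).
    case=> _; rewrite eqn_leq le dimvS ?addvSl //= subv_add memvE => /esym/andP[_ ->].
    by [].
  have decomp z : z \in orth x -> exists k, z - k *: v \in W1.
    rewrite OE => /memv_addP[w wW [_ /vlineP[k ->] ->]].
    by exists k; rewrite addrK.
  have vuniq p (u : 'rV_p) q : col q (v *m u) \in W1 -> u 0 q = 0.
    rewrite col_outer => uW; apply/eqP; apply: contraNT vW => uq.
    by move: uW; rewrite rpredZeq (negPf uq).
  have W1mul (M : 'M[F]_(N, n)) : (forall q, col q M \in W1) -> forall l,
    col l (M *m y) \in W1.
    move=> MW l; rewrite [M]mx_sum_col mulmx_suml linear_sum rpred_sum // => q _.
    by rewrite /= colembE -mulmxA col_outer memvZ.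
  pose S := [set q | ~~ (orth x :&: zeros (C q) <= W1)%VS].
  have inS q z : q \notin S -> z \in (orth x :&: zeros (C q))%VS -> z \in W1.
    by rewrite inE negbK => /subvP; apply.
  have [vq vqP] : exists vq, forall q, q \in S ->
      vq q \in (orth x :&: zeros (C q))%VS /\ vq q - v \in W1.
    apply: (@fin_all_exists _ _ (fun q z => q \in S ->
      z \in (orth x :&: zeros (C q))%VS /\ z - v \in W1)) => q.
    have [|] := boolP (q \in S); last by exists 0.
    rewrite inE => /subvPn[z zO zW]; have [k kz] : exists k, z - k *: v \in W1.
      by apply: decomp; move: zO; rewrite memv_cap => /andP[].
    have k0 : k != 0 by apply: contraNneq zW => k0; rewrite k0 scale0r subr0 in kz.
    exists (k^-1 *: z) => _; split; first exact: memvZ.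
    by rewrite -[v]scale1r -(mulVf k0) -scalerA -scalerBr memvZ.
  (* S indexes the columns of D that are nonzero in the line ker x^T / W1. *)
  case: (dich S) => [indep|spans].
    (* A preimage [M] of [w *m c] is congruent to [v *m u] modulo [W1], with [u] supported on [S].
       Then [u *m y = 0], so [u = 0] and the columns of [M] lie in [W1]. *)
    apply: (concl W1) => // w c wW; have /memv_imgP[M MD wcE] := W1im w c wW.
    have MO q : col q M \in (orth x :&: zeros (C q))%VS by move/mem_colspace: MD; apply.
    have [u uM] : exists u : 'rV_n, forall q, col q (M - v *m u) \in W1.
      have [|f fP] := @fin_all_exists _ _ (fun q k => col q M - k *: v \in W1).
        by move=> q; apply: decomp; have := MO q; rewrite memv_cap => /andP[].
      by exists (\row_q f q) => q; rewrite linearB /= col_outer mxE.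
    have u0 : u = 0.
      apply: indep => [q qS|].
        apply: vuniq; have -> : col q (v *m u) = col q M - col q (M - v *m u).
          by rewrite linearB /= opprB addrC subrK.
        by rewrite rpredB // (inS q).
      apply/rowP => l; rewrite [RHS]mxE; apply: vuniq; rewrite mulmxA.
      have -> : v *m u *m y = w *m c - (M - v *m u) *m y.
        by rewrite wcE rmulE mulmxBl opprB addrC subrK.
      by rewrite linearB rpredB ?W1mul //= col_outer memvZ.
    rewrite wcE; apply/memv_img/mem_colspace => q; have := MO q.
    by rewrite !memv_cap => /andP[_ ->]; have := uM q; rewrite u0 mulmx0 subr0 => ->.
  (* If [u *m y = c] with [u] supported on [S], replacing [v] by [vq q] in column [q] of [v *m u]
     gives a matrix in [solsp]. Its image is [v *m c] up to columns in [W1], which [W1im]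
     handles. *)
  apply: concl3 => z c; rewrite OE => /memv_addP[w wW [_ /vlineP[k ->] ->]].
  rewrite mulmxDl; apply: memvD; first exact: W1im.
  rewrite -scalemxAl; apply: memvZ.
  have [u [uS <-]] := spans c.
  pose M : 'M[F]_(N, n) := \matrix_(i, q) (u 0 q * vq q i 0).
  have ME q : col q M = u 0 q *: vq q by apply/colP => i; rewrite !mxE.
  have -> : v *m (u *m y) = rmul y M - (M - v *m u) *m y.
    by rewrite rmulE mulmxBl opprB addrC subrK mulmxA.
  rewrite rpredB //.
    apply/memv_img/mem_colspace => q; rewrite ME; have [qS|/uS->] := boolP (q \in S).
      by rewrite memvZ //; case: (vqP q qS).
    by rewrite scale0r mem0v.
  rewrite [_ *m y]mx_sum_col rpred_sum // => l _; rewrite colembE W1im //.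
  apply: W1mul => q; rewrite linearB /= col_outer ME -scalerBr.
  have [qS|/uS->] := boolP (q \in S); last by rewrite scale0r mem0v.
  by rewrite memvZ //; case: (vqP q qS).
rewrite ltnS leq_eqVlt => /predU1P[d1|].
  have [z z0 W1E] : exists2 z, z != 0 & W1 = <[z]>%VS.
    have z0 : vpick W1 != 0 by rewrite vpick0 -dimv_eq0 d1.
    exists (vpick W1) => //; apply/eqP; rewrite eq_sym eqEdim -memvE memv_pick.
    by rewrite d1 dim_vline z0.
  (* The matrix [z *m u] has the prescribed zeros exactly when [u] is supported on [S]. Independent
     rows would leave no nonzero null matrix, against [\dim W1 = 1]; spanning rows give the image
     required for [W1]. *)
  pose S := [set q | z \in zeros (C q)].
  case: (dich S) => [indep|spans].
    suff : W1 = 0%VS by move/eqP; rewrite -dimv_eq0 d1.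
    apply/eqP; rewrite -subv0; apply/subv_sumP => q _;
      apply/subvP => _ /memv_imgP[M MN ->].
    have [MO My] := NlP M MN.
    have [u uM] : exists u : 'rV_n, M = z *m u.
      have [|f fP] := @fin_all_exists _ _ (fun q k => col q M = k *: z).
        by move=> p; apply/vlineP; rewrite -W1E colW1.
      by exists (\row_q f q); rewrite [M]mx_sum_col [RHS]mx_sum_col;
        apply: eq_bigr => p _;
         rewrite col_outer mxE fP.
    have [i zi] : exists i, z i 0 != 0.
      by apply/existsP; apply: contraNT z0; rewrite negb_exists => /forallP zi;
         apply/eqP/colP => i; rewrite mxE; apply/eqP; have := zi i; rewrite negbK.
    rewrite lfunE /= uM (indep u) ?mulmx0 ?linear0 ?mem0v // => [p|].
      rewrite inE => pS; apply/eqP; apply: contraNT pS => up.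
      have := MO p; rewrite memv_cap => /andP[_]; rewrite uM col_outer.
      by rewrite rpredZeq (negPf up).
    apply/rowP => l; move/matrixP/(_ i l): My; rewrite uM -mulmxA mxE big_ord1 !mxE =>
      /eqP.
    by rewrite mulf_eq0 (negPf zi) => /eqP.
  apply: (concl W1) => // w c; rewrite [in w \in _]W1E => /vlineP[k ->].
  have [u [uS uy]] := spans (k *: c).
  rewrite -scalemxAl scalemxAr -uy mulmxA -rmulE; apply/memv_img/mem_colspace => q.
  rewrite col_outer; have [|/uS->] := boolP (q \in S); last by rewrite scale0r mem0v.
  by rewrite inE => zq; rewrite memvZ // memv_cap zq W1E memv_line.
rewrite ltnS leqn0 dimv_eq0 => /eqP W0.
apply: (concl 0%VS) => //; first by rewrite W0.
  exact: sub0v.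
by move=> w c; rewrite memv0 => /eqP->; rewrite mul0mx mem0v.
Qed.

End NullSpaceUpper.

(** * A generic x *)

Section GenericPoints.
Variable F : fieldType.
Hypothesis F_infinite : forall p : {poly F}, p != 0 -> exists t, p.[t] != 0.

(** On the line from a point good for the conditions met so far to a point good for the next one,
    each of these conditions is a nonzero polynomial in the parameter, so one parameter avoids all
    their roots. *)
Lemma common_nonzero (I : finType) (J : Type) (g : I -> (J -> F) -> F) :
    (forall i w v, exists h : {poly F},
       forall s, h.[s] = g i (fun j => w j + s * (v j - w j))) ->
    (forall i, exists w, g i w != 0) ->
  exists w, forall i, g i w != 0.
Proof.
move=> gpoly gnz; suff [w wP] : exists w, forall i, i \in enum I -> g i w != 0.
  by exists w => i; apply: wP; rewrite mem_enum.
elim: (enum I) => [|i s [w wP]]; first by exists (fun=> 0).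
have [v vP] := gnz i.
have [h hP] := fin_all_exists (fun j => gpoly j w v).
have [|t ht] := F_infinite (p := h i * \prod_(j <- s) h j).
  rewrite mulf_neq0 //.
    apply: contraNneq vP => h0; have := hP i 1; rewrite h0 horner0 => /eqP;
      rewrite eq_sym.
    by congr (g i _ == 0); apply/funext => j; rewrite mul1r addrC subrK.
  rewrite prodf_seq_neq0; apply/allP => j js /=.
  apply: contraNneq (wP j js) => h0; have := hP j 0; rewrite h0 horner0 => /eqP;
    rewrite eq_sym.
  by congr (g j _ == 0); apply/funext => k; rewrite mul0r addr0.
exists (fun j => w j + t * (v j - w j)) => j.
move: ht; rewrite hornerM horner_prod mulf_eq0 negb_or prodf_seq_neq0 =>
  /andP[hi /allP hs].
rewrite inE => /predU1P[->|js]; rewrite -hP //.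
exact: hs.
Qed.

(* The quadratics (T - x1)(T - x2), (T - x3)(T - x4), (T - x5)(T - x6) are
   linearly dependent exactly when this vanishes. *)
Definition involution_det (R : pzRingType) (x1 x2 x3 x4 x5 x6 : R) :=
  ((x3 + x4) - (x1 + x2)) * (x5 * x6 - x1 * x2)
  - ((x5 + x6) - (x1 + x2)) * (x3 * x4 - x1 * x2).

Lemma generic_points N : exists t : 'I_N -> F, injective t /\
  forall i j k l p q, uniq [:: i; j; k; l; p; q] ->
    involution_det (t i) (t j) (t k) (t l) (t p) (t q) != 0.
Proof.
pose g (c : 'I_N * 'I_N + 'I_N * 'I_N * 'I_N * 'I_N * 'I_N * 'I_N) (w : 'I_N -> F) :=
  match c with
  | inl (i, j) => if i == j then 1 else w i - w j
  | inr (i, j, k, l, p, q) => if uniq [:: i; j; k; l; p; q]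
      then involution_det (w i) (w j) (w k) (w l) (w p) (w q) else 1
  end.
have [c w v|c|w wP] := @common_nonzero _ _ g.
- pose L j : {poly F} := (w j)%:P + 'X * (v j - w j)%:P.
  case: c => [[i j]|[[[[[i j] k] l] p] q]]; rewrite /g; [case: (i == j)|case: (uniq _)].
  + by exists 1 => s; rewrite hornerE.
  + by exists (L i - L j) => s; rewrite !hornerE.
  + exists (involution_det (L i) (L j) (L k) (L l) (L p) (L q)) => s.
    by rewrite /involution_det /L !hornerE.
  + by exists 1 => s; rewrite hornerE.
- case: c => [[i j]|[[[[[i j] k] l] p] q]]; rewrite /g.
    case: eqP => [_|/eqP ij]; first by exists (fun=> 0); rewrite oner_eq0.
    by exists (fun u => (u == i)%:R); rewrite eqxx (eq_sym j) (negPf ij) subr0 oner_eq0.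
  case ijklpq: (uniq _); last by exists (fun=> 0); rewrite oner_eq0.
  (* At this point the three quadratics are [(T - 1)^2], [(T - 1) T] and [T^2], which are
     independent. *)
  exists (fun u => (u \in [:: i; j; k])%:R).
  have notin u : u \in [:: l; p; q] -> u \in [:: i; j; k] = false.
    move: ijklpq; rewrite (cat_uniq [:: i; j; k] [:: l; p;
      q]) => /and3P[_ /hasPn nin _].
    by move=> /nin/negPf.
  rewrite (notin l) ?(notin p) ?(notin q) ?inE ?eqxx ?orbT //=.
  suff -> : involution_det 1 1 1 0 0 0 = - 1 :> F by rewrite oppr_eq0 oner_eq0.
  by rewrite /involution_det; ring.
exists w; split=> [i j|i j k l p q u].
  by move=> wij; apply/eqP; have := wP (inl (i, j)); rewrite /g; case: (i == j) => //;
    rewrite wij subrr eqxx.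
by have := wP (inr (i, j, k, l, p, q)); rewrite /g u.
Qed.

End GenericPoints.

Section Quadratics.
Variable F : fieldType.

Definition quad (c0 c1 c2 s : F) := c0 + c1 * s + c2 * s ^+ 2.

Lemma quad_root2 c0 c1 c2 u v s : u != v ->
  quad c0 c1 c2 u = 0 -> quad c0 c1 c2 v = 0 ->
  quad c0 c1 c2 s = c2 * (s - u) * (s - v).
Proof.
rewrite /quad -subr_eq0 => uv u0 v0.
have c1E : c1 = - c2 * (u + v).
  apply: (mulfI uv); apply/eqP; rewrite -subr_eq0; apply/eqP.
  by rewrite -[RHS](subrr 0) -{1}u0 -{1}v0; ring.
have c0E : c0 = c2 * u * v by rewrite -[LHS]subr0 -u0 c1E; ring.
by rewrite c0E c1E; ring.
Qed.

Lemma quad_root3 c0 c1 c2 u v w : uniq [:: u; v; w] ->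
  quad c0 c1 c2 u = 0 -> quad c0 c1 c2 v = 0 -> quad c0 c1 c2 w = 0 ->
  [/\ c0 = 0, c1 = 0 & c2 = 0].
Proof.
rewrite /= !inE negb_or andbT => /andP[/andP[uv uw] vw] u0 v0 w0.
have c20 : c2 = 0.
  move: w0; rewrite (quad_root2 w uv u0 v0) => /eqP; rewrite !mulf_eq0 !subr_eq0.
  by rewrite (eq_sym w u) (eq_sym w v) (negPf uw) (negPf vw) !orbF => /eqP.
have q s : quad c0 c1 c2 s = 0 by rewrite (quad_root2 s uv u0 v0) c20 !mul0r.
have := q 0; rewrite /quad mulr0 expr0n mulr0 !addr0 => c00.
by have := q 1; rewrite /quad c20 c00 mulr1 mul0r addr0 add0r.
Qed.

(** [V] is a Vandermonde matrix of rank 3. The columns of [x] form a basis of its left kernel, so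
    that [orth x] is the column space of [V]. *)
Lemma exists_quadratic_orth a (t : 'I_a.+3 -> F) : injective t ->
  exists x : 'M[F]_(a.+3, a), \dim (orth x) = 3 /\
    forall z, z \in orth x -> exists c0 c1 c2, forall i, z i 0 = quad c0 c1 c2 (t i).
Proof.
move=> tinj; pose V : 'M[F]_(a.+3, 3) := \matrix_(i, k) t i ^+ k.
have VE (c : 'cV_3) i : (V *m c) i 0 = quad (c 0 0) (c 1 0) (c 2 0) (t i).
  rewrite mxE !big_ord_recl big_ord0 !mxE /quad expr0 expr1 mul1r addr0 addrA.
  by rewrite (mulrC (t i)) (mulrC (_ ^+ _)); do 2?congr (_ + _ * _); congr (c _ _);
    apply: val_inj.
have Vker (c : 'cV_3) : V *m c = 0 -> c = 0.
  move=> Vc; have r i : quad (c 0 0) (c 1 0) (c 2 0) (t i) = 0 by rewrite -VE Vc mxE.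
  pose i1 : 'I_a.+3 := inord 1; pose i2 : 'I_a.+3 := inord 2.
  have [|c0 c1 c2] := quad_root3 _ (r 0) (r i1) (r i2).
    rewrite /= !inE !(inj_eq tinj) negb_or -!val_eqE /= !inordK //.
  apply/colP => k; rewrite mxE.
  by case: k => -[|[|[|//]]] h; [rewrite -[RHS]c0|rewrite -[RHS]c1|rewrite -[RHS]c2];
    congr (c _ _); apply: val_inj.
have rV : \rank V = 3.
  rewrite -mxrank_tr; apply/eqP; rewrite -/(row_free _) -kermx_eq0;
    apply/rowV0P => u /sub_kermxP.
  by move/(congr1 trmx); rewrite trmx_mul trmxK trmx0 => /Vker/(congr1 trmx);
    rewrite trmxK trmx0.
have rK : \rank (kermx V) = a by rewrite mxrank_ker rV !subSS subn0.
pose B := castmx (rK, erefl a.+3) (row_base (kermx V)).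
have Bfree : row_free B by rewrite /B row_free_castmx row_base_free.
have BV : B *m V = 0.
  apply/sub_kermxP; rewrite /B eqmx_cast; by rewrite eq_row_base.
exists B^T.
have dO : \dim (orth B^T) = 3.
  have := limg_ker_dim (linfun (mulmx B^T^T : 'cV[F]_a.+3 -> 'cV[F]_a)) fullv.
  rewrite capfv -/(orth _) dimvf dim_mx muln1.
  have -> : (linfun (mulmx B^T^T : 'cV[F]_a.+3 -> 'cV[F]_a) @: fullv)%VS = fullv.
    apply/eqP; rewrite eqEsubv subvf; apply/subvP => z _.
    have [B' BB'] := row_freeP Bfree; apply/memv_imgP; exists (B' *m z);
      rewrite ?memvf //.
    by rewrite lfunE /= trmxK mulmxA BB' mul1mx.
  by rewrite dimvf dim_mx muln1 => dE; apply: (@addIn a); rewrite dE.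
split=> // z zO.
pose L := (linfun (mulmx V : 'cV[F]_3 -> 'cV[F]_a.+3) @: fullv)%VS.
have : z \in L.
  suff -> : L = orth B^T by [].
  apply/eqP; rewrite eqEdim dO limg_dim_eq ?dimvf ?dim_mx ?andbT; last first.
    apply/eqP; rewrite capfv -subv0; apply/subvP => c; rewrite memv_ker lfunE =>
      /eqP/Vker->.
    exact: mem0v.
  apply/subvP => _ /memv_imgP[c _ ->]; rewrite mem_orth lfunE /= trmxK mulmxA BV mul0mx.
  by rewrite eqxx.
case/memv_imgP => c _ ->; rewrite lfunE /=.
by exists (c 0 0), (c 1 0), (c 2 0) => i; rewrite VE.
Qed.

End Quadratics.

Lemma exists_subset_card (T : finType) (A V : {set T}) k :
    A \subset V -> (#|A| <= k <= #|V|)%N ->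
  exists B : {set T}, [/\ A \subset B, B \subset V & #|B| = k].
Proof.
move=> AV /andP[Ak kV]; elim: k Ak kV => [|k IHk] Ak kV.
  by exists A; split=> //; apply/eqP; rewrite -leqn0.
move: Ak; rewrite leq_eqVlt => /predU1P[<-|Ak]; first by exists A.
have [B [AB BV Bk]] := IHk Ak (ltnW kV).
have /subsetPn[v vV vB] : ~~ (V \subset B).
  by apply: contraL kV => /subset_leq_card; rewrite Bk -leqNgt.
exists (v |: B); split; last by rewrite cardsU1 vB Bk.
  exact: subset_trans AB (subsetUr _ _).
by rewrite subUset sub1set vV.
Qed.

(** * Generic position of [ker x^T] and the subspaces that matter *)

Section GenericOrth.
Variables (F : fieldType) (a : nat).
Implicit Types (W : {vspace 'cV[F]_a.+3}) (A B D : {set 'I_a.+3}).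

(** The second condition makes each [orth x :&: zeros A] as small as possible. By the third, a plane
    in [orth x] contains nonzero vectors vanishing on at most two of any three disjoint pairs of
    coordinates. *)
Definition generic (x : 'M[F]_(a.+3, a)) :=
  [/\ \dim (orth x) = 3,
      forall A, #|A| = 3 -> (orth x :&: zeros A = 0)%VS &
      forall A B D W, #|A| = 2 -> #|B| = 2 -> #|D| = 2 ->
        [disjoint A & B] -> [disjoint A & D] -> [disjoint B & D] ->
        (W <= orth x)%VS -> \dim W = 2 -> (W :&: zeros A != 0)%VS ->
        (W :&: zeros B != 0)%VS -> (W :&: zeros D == 0)%VS].

Hypothesis F_infinite : forall p : {poly F}, p != 0 -> exists t, p.[t] != 0.

(** For values of quadratics at generic points, the second condition holds because a nonzero
    quadratic has at most two roots. In the third, three vectors violating it would be multiples of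
    [(T - t i)(T - t j)] and its analogues, which are independent and do not fit into a plane. *)
Lemma exists_generic : exists x, generic x.
Proof.
have [t [tinj tdet]] := generic_points F_infinite a.+3.
have [x [dO xq]] := exists_quadratic_orth tinj; exists x; split=> // [A A3|].
  apply/eqP; rewrite -subv0; apply/subvP => z;
    rewrite memv_cap => /andP[/xq[c0 [c1 [c2 zE]]] /mem_zeros zA].
  have := enum_uniq A; have : size (enum A) = 3 by rewrite -cardE.
  case E: (enum A) => [|i [|j [|k [|]]]] //= _ u.
  have zA' m : m \in [:: i; j; k] -> quad c0 c1 c2 (t m) = 0.
    by rewrite -E mem_enum -zE => /zA.
  have [||||c00 c10 c20] := @quad_root3 _ c0 c1 c2 (t i) (t j) (t k).
  - by move: u; rewrite /= !inE !(inj_eq tinj).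
  - by apply: zA'; rewrite !inE eqxx.
  - by apply: zA'; rewrite !inE eqxx orbT.
  - by apply: zA'; rewrite !inE eqxx !orbT.
  rewrite memv0; apply/eqP/colP => m.
  by rewrite zE c00 c10 c20 /quad !mul0r !addr0 mxE.
move=> A B D W /eqP/cards2P[i [j [ij ->]]] /eqP/cards2P[k [l [kl ->]]] /eqP/cards2P[p
  [q [pq ->]]].
move=> AB AD BD WO dW WA WB; apply/negPn/negP => WD.
have ne (A' B' : {set 'I_a.+3}) u v : [disjoint A' & B'] -> u \in A' -> v \in B' ->
  u != v.
  by move=> /disjointFr dis uA vB; apply: contraTneq vB => <-; rewrite dis.
have neAB u v := ne _ _ u v AB.
have neAD u v := ne _ _ u v AD.
have neBD u v := ne _ _ u v BD.
have u6 : uniq [:: i; j; k; l; p; q].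
  rewrite /= !inE !negb_or ij kl pq /=.
  rewrite (neAB i k) ?(neAB i l) ?(neAB j k) ?(neAB j l) ?set21 ?set22 //.
  rewrite (neAD i p) ?(neAD i q) ?(neAD j p) ?(neAD j q) ?set21 ?set22 //.
  by rewrite (neBD k p) ?(neBD k q) ?(neBD l p) ?(neBD l q) ?set21 ?set22.
have zP (u v : 'I_a.+3) : u != v -> (W :&: zeros [set u; v] != 0)%VS ->
    exists z c, [/\ z \in W, c != 0 & forall m, z m 0 = quad (c * t u * t v) (- c *
      (t u + t v)) c (t m)].
  move=> uv; rewrite -vpick0; set z := vpick _ => z0.
  have := memv_pick (W :&: zeros [set u; v])%VS;
    rewrite -/z memv_cap => /andP[zW /mem_zeros zuv].
  have [c0 [c1 [c2 zE]]] := xq z (subvP WO z zW).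
  have tuv : t u != t v by rewrite (inj_eq tinj).
  have zE' m : z m 0 = c2 * (t m - t u) * (t m - t v).
    by rewrite zE; apply: quad_root2 => //; rewrite -zE zuv // !inE eqxx ?orbT.
  exists z, c2; split=> // [|m]; last by rewrite zE' /quad; ring.
  apply: contraNneq z0 => c20; apply/eqP/colP => m.
  by rewrite zE' c20 !mul0r mxE.
have [zA [cA [zAW cA0 zAE]]] := zP i j ij WA.
have [zB [cB [zBW cB0 zBE]]] := zP k l kl WB.
have [zD [cD [zDW cD0 zDE]]] := zP p q pq WD.
have : free [tuple of [:: zA; zB; zD]].
  apply/freeP => e; rewrite !big_ord_recl big_ord0 /= addr0 => e0.
  set e1 := e _ in e0; set e2 := e _ in e0; set e3 := e _ in e0.
  pose b1 := e1 * cA; pose b2 := e2 * cB; pose b3 := e3 * cD.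
  pose s1 := t i + t j; pose s2 := t k + t l; pose s3 := t p + t q.
  pose p1 := t i * t j; pose p2 := t k * t l; pose p3 := t p * t q.
  have eq0 m : quad (b1 * p1 + b2 * p2 + b3 * p3) (- (b1 * s1 + b2 * s2 + b3 * s3))
    (b1 + b2 + b3) (t m) = 0.
    move/colP/(_ m): e0; rewrite !mxE zAE zBE zDE => <-.
    by rewrite /quad /b1 /b2 /b3 /s1 /s2 /s3 /p1 /p2 /p3; ring.
  have [|P S B1] := quad_root3 _ (eq0 i) (eq0 j) (eq0 k).
    move: u6; rewrite /= !inE !(inj_eq tinj) !negb_or => /and4P[/and5P[-> ->
      _ _ _] /and4P[-> _ _ _] _ _].
    by [].
  have Det := tdet _ _ _ _ _ _ u6; rewrite /involution_det -/s1 -/s2 -/s3 -/p1 -/p2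
    -/p3 in Det.
  (* Eliminating [b1] from the three coefficient equations leaves two linear equations in [b2] and
     [b3] whose determinant is nonzero by [Det]. *)
  have b20 : b2 = 0.
    apply: (mulIf Det); rewrite mul0r.
    rewrite -[RHS](_ : (p3 - p1) * ((b1 * s1 + b2 * s2 + b3 * s3) - s1 * (b1 + b2 + b3))
      - (s3 - s1) * ((b1 * p1 + b2 * p2 + b3 * p3) - p1 * (b1 + b2 + b3)) = 0);
        first by ring.
    by rewrite P B1 -[b1 * s1 + _ + _]opprK S; ring.
  have b30 : b3 = 0.
    apply: (mulIf Det); rewrite mul0r.
    rewrite -[RHS](_ : (s2 - s1) * ((b1 * p1 + b2 * p2 + b3 * p3) - p1 * (b1 + b2 + b3))
      - (p2 - p1) * ((b1 * s1 + b2 * s2 + b3 * s3) - s1 * (b1 + b2 + b3)) = 0);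
        first by ring.
    by rewrite P B1 -[b1 * s1 + _ + _]opprK S; ring.
  have b10 : b1 = 0 by move: B1; rewrite b20 b30 !addr0.
  have e10 : e1 = 0 by apply: (mulIf cA0); rewrite mul0r.
  have e20 : e2 = 0 by apply: (mulIf cB0); rewrite mul0r.
  have e30 : e3 = 0 by apply: (mulIf cD0); rewrite mul0r.
  case=> -[|[|[|//]]] h; [rewrite -[RHS]e10|rewrite -[RHS]e20|rewrite -[RHS]e30];
    congr e; exact: val_inj.
rewrite /free => /eqP d3; have : (\dim <<[:: zA; zB; zD]>> <= \dim W)%N.
  by apply/dimvS/span_subvP => z; rewrite !inE => /or3P[] /eqP->.
by rewrite d3 dW.
Qed.

Variables (x : 'M[F]_(a.+3, a)) (n b : nat) (C : 'I_n -> {set 'I_a.+3}).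
Hypothesis xgen : generic x.

(** If [A] has more than three elements, three of them already leave only 0. Otherwise [A] is
    extended to a triple: the added coordinates cut at most [3 - #|A|] dimensions and leave 0. *)
Lemma dim_orth_zeros A : (\dim (orth x :&: zeros A) <= 3 - #|A|)%N.
Proof.
have [dO O0 _] := xgen; have [A3|A3] := leqP #|A| 3; last first.
  have [||B [_ BA B3]] := @exists_subset_card _ set0 A 3;
    rewrite ?sub0set ?cards0 ?(ltnW A3) //.
  rewrite (_ : orth x :&: zeros A = 0)%VS ?dimv0 //; apply/eqP.
  rewrite -subv0 -(O0 B B3) capvS //; apply/subvP => z /mem_zeros zA.
  by apply/mem_zeros => i /(subsetP BA)/zA.
have [||B [AB _ B3]] := @exists_subset_card _ A [set: 'I_a.+3] 3;
  rewrite ?subsetT ?A3 ?cardsT ?card_ord //.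
have := dim_cap_zerosD B (capvSr (orth x) (zeros A)).
rewrite (_ : orth x :&: zeros A :&: zeros B = 0)%VS ?dimv0.
  by rewrite leqn0 subn_eq0 cardsD (setIidPr AB) B3.
by apply/eqP; rewrite -subv0 -(O0 B B3) capvS ?capvSl.
Qed.

(** The subspace [W] is classified by its dimension, and each [W :&: zeros (C q)] is compared with
    the matching summand of [null_bound]. *)
Lemma null_bound_upper (y : 'M[F]_(n, b)) W : (W <= orth x)%VS ->
    (\dim (nullsp x y C) + b * \dim W <= \sum_q \dim (W :&: zeros (C q)))%N ->
  exists i j k l, exists2 c, c \in null_bound b C i j k l & (\dim (nullsp x y C) <=
    c)%N.
Proof.
move=> WO Nle; have [dO O0 O3] := xgen.
have fin r (g : 'I_n -> nat) : \dim W = r -> (forall q, (\dim (W :&: zeros (C q)) <=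
  g q)%N) ->
    (\dim (nullsp x y C) <= \sum_q g q - r * b)%N.
  move=> dW Wg; rewrite mulnC -dW; have := leq_trans Nle (leq_sum _ (fun q _ => Wg q)).
  by move=> le; rewrite leq_subRL 1?addnC // (leq_trans _ le) // leq_addl.
have dWA A : (\dim (W :&: zeros A) <= 3 - #|A|)%N.
  by apply: leq_trans (dimvS (capvS WO (subvv _))) (dim_orth_zeros A).
have := dimvS WO; rewrite dO leq_eqVlt => /predU1P[d3|].
  exists ord0, ord0, ord0, ord0; eexists; first by rewrite !inE; apply/or4P/Or41/eqxx.
  by apply: fin => // q; rewrite setD0.
rewrite ltnS leq_eqVlt => /predU1P[d2|].
  have [[i Wi]|Wni] := pselect (exists i, (W <= zeros [set i])%VS).
    exists i, ord0, ord0, ord0; eexists; first by rewrite !inE; apply/or4P/Or42/eqxx.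
    apply: fin => // q; apply: leq_trans (_ : 3 - #|C q :|: [set i]| <= _)%N.
      apply: leq_trans (dWA _); rewrite zerosU; apply/dimvS.
      by rewrite !subv_cap capvSl capvSr (subv_trans (capvSl _ _) Wi).
    by rewrite setUC cardsU1 (cardsD1 i (C q)); case: (i \in C q).
  have W1 i : (\dim (W :&: zeros [set i]) <= 1)%N.
    rewrite leqNgt; apply/negP => W2; apply: Wni; exists i; apply/capv_idPl/eqP.
    by rewrite eqEdim capvSl d2.
  (* Distinct pairs satisfying [P] are disjoint: otherwise one line of [W] would vanish on three
     coordinates. The last condition of [generic] then leaves at most two such pairs. *)
  pose P A := (#|A| == 2) && (W :&: zeros A != 0)%VS.
  have Pdisj A B : P A -> P B -> A != B -> [disjoint A & B].
    move=> /andP[/eqP A2 WA0] /andP[/eqP B2 WB0] AB;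
      apply: contraT => /pred0Pn[i /andP[/= iA iB]].
    have inc D : i \in D -> (W :&: zeros D != 0)%VS -> (W :&: zeros D = W :&:
      zeros [set i])%VS.
      move=> iD WD; apply/eqP; rewrite eqEdim (leq_trans (W1 i)) ?lt0n ?dimv_eq0 //
        andbT.
      by apply: capvS => //; apply/subvP => z /mem_zeros zD;
        apply/mem_zeros => j /set1P->; apply: zD.
    have AB3 : (2 < #|A :|: B|)%N.
      rewrite ltnNge; apply: contra AB => AB2.
      have /eqP AE : A == A :|: B by rewrite eqEcard subsetUl A2.
      by rewrite eq_sym eqEcard A2 B2 AE subsetUr.
    case/negP: (WA0); rewrite -dimv_eq0 -leqn0.
    have -> : (W :&: zeros A = W :&: zeros (A :|: B))%VS.
      have WAB : (W :&: zeros A = W :&: zeros B)%VS by rewrite (inc A) // (inc B).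
      by rewrite zerosU capvA [in RHS]WAB -capvA capvv.
    by apply: leq_trans (dWA _) _; rewrite leqn0 subn_eq0.
  have [i [j [k [l Pij]]]] : exists i j k l, forall A, P A -> A = [set i;
    j] \/ A = [set k; l].
    have [[A PA]|nP] := pselect (exists A, P A); last first.
      by exists ord0, ord0, ord0, ord0 => A PA; case: nP; exists A.
    have /andP[/cards2P[i [j [_ AE]]] WA] := PA.
    have [[B [PB AB]]|nP] := pselect (exists B, P B /\ A != B); last first.
      exists i, j, i, j => B PB; left; rewrite -AE; apply/esym/eqP;
        apply: contrapT => /negP AB.
      by apply: nP; exists B.
    have /andP[/cards2P[k [l [_ BE]]] WB] := PB.
    exists i, j, k, l => D PD; rewrite -AE -BE; have [<-|AD] := eqVneq A D;
      first by left.
    have [<-|BD] := eqVneq B D; first by right.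
    have /andP[D2 /negP[]] := PD; move/andP: PA (PA) => [A2 _] PA;
      move/andP: PB (PB) => [B2 _] PB.
    by apply: (O3 A B D) => //; rewrite ?Pdisj //; apply/eqP.
  exists i, j, k, l; eexists; first by rewrite !inE; apply/or4P/Or44/eqxx.
  apply: fin => // q; rewrite setD0; set A := C q.
  have [A0|A0] := leqP #|A| 0.
    by rewrite leq_max (leq_trans (dimvS (capvSl _ _))) // d2; move: A0;
      rewrite leqn0 => /eqP->.
  have [A1|A1] := leqP #|A| 1.
    have /cards1P[u Au] : #|A| == 1 by rewrite eqn_leq A1 A0.
    by rewrite leq_max Au cards1 W1.
  have [A2|A2] := leqP #|A| 2; last first.
    by apply: leq_trans (dWA A) _; rewrite (_ : 3 - #|A| = 0)%N //; apply/eqP;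
      rewrite subn_eq0.
  have A2E : #|A| = 2 by apply/eqP; rewrite eqn_leq A2 A1.
  have [->|WA] := eqVneq (W :&: zeros A)%VS 0%VS; first by rewrite dimv0.
  apply: leq_trans (dWA A) _; rewrite A2E !leq_max.
  have [|->|->] := Pij A; first by rewrite /P A2E eqxx.
    by rewrite setDv cards0 !orbT.
  by rewrite setDv cards0 !orbT.
rewrite ltnS leq_eqVlt => /predU1P[d1|].
  have z0 : vpick W != 0 by rewrite vpick0 -dimv_eq0 d1.
  set z := vpick W in z0; have zW : z \in W := memv_pick W.
  (* A generator [z] of the line has at most two zero coordinates, which are completed to a pair. A
     column contributes only if [C q] lies among the zeros of [z]. *)
  pose Z := [set i | z i 0 == 0].
  have Z2 : (#|Z| <= 2)%N.
    have zO : z \in (orth x :&: zeros Z)%VS.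
      by rewrite memv_cap (subvP WO) //; apply/mem_zeros => i; rewrite inE => /eqP.
    rewrite leqNgt; apply/negP => Z3; have := dim_orth_zeros Z.
    have -> : (3 - #|Z| = 0)%N by apply/eqP; rewrite subn_eq0.
    by rewrite leqn0 dimv_eq0 => /eqP O; move: zO; rewrite O memv0 (negPf z0).
  have [||B [ZB _ /eqP/cards2P[i [j [ij BE]]]]] := @exists_subset_card _ Z [set:
    'I_a.+3] 2.
  - exact: subsetT.
  - by rewrite Z2 cardsT card_ord.
  exists i, j, ord0, ord0; eexists; first by rewrite !inE; apply/or4P/Or43/eqxx.
  rewrite -[b in (_ - b)%N]mul1n; apply: fin => // q.
  have [/eqP CB|/set0Pn[u]] := boolP (C q :\: [set i; j] == set0).
    by rewrite (leq_trans (dimvS (capvSl _ _))) // d1 CB cards0.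
  rewrite inE -BE => /andP[uB uC]; rewrite (_ : W :&: zeros (C q) = 0)%VS ?dimv0 //.
  apply/eqP; rewrite -subv0; apply/subvP => w /memv_capP[wW /mem_zeros wC].
  have : w \in <[z]>%VS.
    have -> : <[z]>%VS = W by apply/eqP; rewrite eqEdim -memvE zW d1 dim_vline z0.
    by [].
  case/vlineP => k wE; move: (wC u uC); rewrite wE mxE => /eqP; rewrite mulf_eq0.
  case/orP => [/eqP->|zu]; first by rewrite scale0r mem0v.
  by move: uB; rewrite (subsetP ZB) // inE.
rewrite ltnS leqn0 => /eqP d0.
(* For [W = 0] the nullity is 0, so any member of the list will do. *)
exists ord0, ord0, ord0, ord0; eexists; first by rewrite !inE; apply/or4P/Or41/eqxx.
apply: leq_trans (leq0n _); apply: leq_trans (fin _ (fun=> 0)%N d0 _) _.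
  by move=> q; rewrite (leq_trans (dimvS (capvSl _ _))) // d0.
by rewrite sum_nat_const muln0.
Qed.

End GenericOrth.

(** * The rank formula *)

Lemma column_indepP (K : fieldType) (I J : finType) (M : I -> J -> K) (S : {set J}) :
  reflect (forall v : J -> K, (forall r, \sum_(c in S) M r c * v c = 0) ->
             forall c, c \in S -> v c = 0)
          (column_indep M S).
Proof.
have mulE (u : 'rV_#|S|) (v : J -> K) r : (forall i, u 0 i = v (enum_val i)) ->
    (u *m (column_mx M S)^T) 0 r = \sum_(c in S) M (enum_val r) c * v c.
  move=> uv; rewrite mxE [RHS]big_enum_val; apply: eq_bigr => i _.
  by rewrite !mxE uv mulrC.
rewrite /column_indep; apply: (iffP idP) => [fr v v0 c cS|H].
  pose u := \row_(i < #|S|) v (enum_val i).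
  have uE i : u 0 i = v (enum_val i) by rewrite mxE.
  have : u = 0.
    apply: (row_free_inj fr); rewrite mul0mx; apply/rowP => r.
    by rewrite (mulE _ _ _ uE) v0 mxE.
  by move/rowP/(_ (enum_rank_in cS c)); rewrite uE enum_rankK_in // mxE.
rewrite -kermx_eq0; apply/rowV0P => u /sub_kermxP u0.
pose v c := \sum_(i < #|S| | enum_val i == c) u 0 i.
have uE i : u 0 i = v (enum_val i).
  by rewrite /v (big_pred1 i) // => j; rewrite (inj_eq enum_val_inj).
apply/rowP => i; rewrite uE mxE H ?enum_valP // => r.
by have /rowP/(_ (enum_rank r)) := u0; rewrite (mulE _ _ _ uE) enum_rankK mxE.
Qed.

Lemma column_rankP (K : fieldType) (I J : finType) (M : I -> J -> K) (E : {set J}) :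
  exists S : {set J}, [/\ S \subset E, column_indep M S & column_rank M E = #|S|].
Proof.
have set0P : (set0 \subset E) && column_indep M set0.
  by rewrite sub0set; apply/column_indepP => v _ c; rewrite inE.
have ne : (0 < #|[pred S : {set J} | (S \subset E) && column_indep M S]|)%N.
  by apply/card_gt0P; exists set0; rewrite inE.
have [S /andP[SE Si] Smax] := eq_bigmax_cond (fun S : {set J} => #|S|) ne.
by exists S; split=> //; apply: etrans Smax; apply: eq_bigl => S'; rewrite inE.
Qed.

Lemma leq_column_rank (K : fieldType) (I J : finType) (M : I -> J -> K) (E S :
  {set J}) :
  S \subset E -> column_indep M S -> (#|S| <= column_rank M E)%N.
Proof. by move=> SE Si; apply: (@leq_bigmax_cond _ _ (fun S : {set J} => #|S|));
  rewrite SE. Qed.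

(** * Specialisation of the indeterminates *)

Section Entries.
Variables (m n a b : nat).

(** Leaving the ring open lets polynomial, fractional and specialised entries share one
    definition. *)
Definition rig_entry (R : nzRingType) (x : 'I_m -> 'I_a -> R) (y : 'I_n -> 'I_b -> R)
    (r : rigidity_row m n a b) (c : 'I_m * 'I_n) : R :=
  match r with
  | inl (j, k) => if c.2 == k then x c.1 j else 0
  | inr (l, i) => if c.1 == i then y c.2 l else 0
  end.

(** A right inverse [B] of the specialised matrix lifts to constant polynomials. The determinant of
    [A *m B'] takes the value 1 at [v], so it is a nonzero polynomial, and [A] has a right inverse
    over the fractions. *)
Lemma column_indep_specialize (F : fieldType) (x : 'I_m -> 'I_a -> F) (y : 'I_n ->
  'I_b -> F) S :
  column_indep (rig_entry x y) S -> column_indep (@rigidity_entry F m n a b) S.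
Proof.
pose R := {mpoly F[#|indet m n a b|]}.
pose v (k : 'I_#|indet m n a b|) : F :=
  match enum_val k with inl (i, j) => x i j | inr (k, l) => y k l end.
pose X (k : indet m n a b) : R := 'X_(enum_rank k).
have vX k : meval v (X k) = match k with inl (i, j) => x i j | inr (k, l) => y k l end.
  by rewrite mevalXU /v enum_rankK.
pose P := rig_entry (fun i j => X (inl (i, j))) (fun k l => X (inr (k, l))).
have PF r c : rig_entry x y r c = meval v (P r c).
  by case: r => [[j k]|[l i]] /=; case: ifP; rewrite ?vX ?meval0.
have PR r c : @rigidity_entry F m n a b r c = tofrac (P r c).
  by case: r => [[j k]|[l i]] /=; case: ifP; rewrite ?tofrac0.
pose A : 'M[R]_(#|S|, #|rigidity_row m n a b|) := \matrix_(c, r) P (enum_val r)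
  (enum_val c).
rewrite /column_indep; have -> : (column_mx (rig_entry x y) S)^T = map_mx (meval v) A.
  by apply/matrixP => c r; rewrite !mxE PF.
have -> : (column_mx (@rigidity_entry F m n a b) S)^T = map_mx (@tofrac R) A.
  by apply/matrixP => c r; rewrite !mxE PR.
case/row_freeP => B AB.
pose B' : 'M[R]_(_, #|S|) := map_mx (@mpolyC _ F) B.
have detAB : \det (A *m B') != 0.
  apply: contraTneq isT => d0; have : meval v (\det (A *m B')) = 1.
    rewrite -det_map_mx map_mxM (_ : map_mx _ B' = B) ?AB ?det1 //.
    by apply/matrixP => i j; rewrite /B' !mxE; apply: mevalC.
  by rewrite d0 meval0 => /esym/eqP; rewrite oner_eq0.
have u : map_mx (@tofrac R) A *m map_mx (@tofrac R) B' \in unitmx.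
  by rewrite unitmxE -map_mxM det_map_mx unitfE tofrac_eq0.
apply/row_freeP; exists (map_mx (@tofrac R) B' *m invmx (map_mx (@tofrac R) A *m map_mx
  (@tofrac R) B')).
by rewrite mulmxA mulmxV.
Qed.

End Entries.

Lemma dim_zeros (F : fieldType) N (A : {set 'I_N}) :
  \dim (zeros A : {vspace 'cV[F]_N}) = (N - #|A|)%N.
Proof.
have le (B : {set 'I_N}) : (N - #|B| <= \dim (zeros B : {vspace 'cV[F]_N}))%N.
  by have := dim_cap_zeros (fullv : {vspace 'cV[F]_N}) B;
    rewrite capfv dimvf dim_mx muln1.
have A0 : (zeros A :&: zeros (~: A) = 0 :> {vspace 'cV[F]_N})%VS.
  apply/eqP; rewrite -subv0; apply/subvP => z /memv_capP[/mem_zeros zA /mem_zeros zA'].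
  rewrite memv0; apply/eqP/colP => i; rewrite mxE.
  by have [/zA //|iA] := boolP (i \in A); rewrite zA' // inE.
have := dimvS (subvf (zeros A + zeros (~: A) : {vspace 'cV[F]_N})%VS).
rewrite dimv_disjoint_sum // dimvf dim_mx muln1.
have := le A; have := le (~: A); rewrite cardsCs setCK card_ord.
have := max_card (mem A); rewrite card_ord; lia.
Qed.

(** * Relations between columns as matrices with prescribed zeros *)

Section Bridge.
Variables (F : fieldType) (m n a b N : nat) (mN : (m <= N)%N).
Local Notation J := ('I_m * 'I_n)%type.
Implicit Types (T : {set J}) (v : J -> F) (M : 'M[F]_(N, n)).
Local Notation w := (widen_ord mN).

(** Rows from [m] on have no preimage and are missing in every column: this pads [E] with empty
    rows. *)
Definition missing T (q : 'I_n) : {set 'I_N} :=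
  [set i | ~~ [exists i', (w i' == i) && ((i', q) \in T)]].

Lemma mem_missing T i q : (w i \in missing T q) = ((i, q) \notin T).
Proof.
rewrite inE; congr (~~ _); apply/existsP/idP => [[i' /andP[/eqP ii' iT]]|iT].
  by have -> : i = i' by apply: val_inj; rewrite /= -[val i]/(val (w i)) -ii'.
by exists i; rewrite eqxx.
Qed.

Lemma missingP T i q : reflect (forall i', w i' = i -> (i', q) \notin T) (i \in missing
  T q).
Proof.
rewrite inE; apply: (iffP existsPn) => H i'.
  by move=> wi; have := H i'; rewrite wi eqxx.
by have [/H //|] := eqVneq (w i') i.
Qed.

(** The sum has at most one term; it extends [v] by zero to the rows from [m] on. *)
Definition mxof v : 'M[F]_(N, n) := \matrix_(i, q) \sum_(i' | w i' == i) v (i', q).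

Lemma mxofE v i q : mxof v (w i) q = v (i, q).
Proof.
by rewrite mxE (big_pred1 i) // => i'; apply/eqP/eqP => [/(congr1 val)/= e|->//];
  apply: val_inj.
Qed.

Lemma mxof0 v i q : (forall i', w i' != i) -> mxof v i q = 0.
Proof. by move=> wi; rewrite mxE big1 // => i' /eqP wi'; have := wi i';
  rewrite wi' eqxx. Qed.

Lemma mxof_linear k v v' : mxof (fun c => k * v c + v' c) = k *: mxof v + mxof v'.
Proof. by apply/matrixP => i q; rewrite !mxE big_split mulr_sumr. Qed.

Definition suppsp T : {vspace 'M[F]_(N, n)} := colspace (fun q => zeros (missing T q)).

Lemma mem_suppsp T M :
  reflect (exists v, (forall c, c \notin T -> v c = 0) /\ M = mxof v) (M \in suppsp T).
Proof.
apply: (iffP (mem_colspace _ _)) => [MT|[v [vT ->]] q].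
  exists (fun c => M (w c.1) c.2); split=> [[i q] iT|].
    by have /mem_zeros/(_ (w i)) := MT q; rewrite mem_missing iT mxE; apply.
  apply/matrixP => i q; have [[i' <-]|nwi] := pselect (exists i', w i' = i);
    first by rewrite mxofE.
  rewrite mxof0; last by move=> i'; apply/negP => /eqP wi; apply: nwi; exists i'.
  have /mem_zeros/(_ i) := MT q; rewrite mxE; apply; apply/missingP => i' wi.
  by case: nwi; exists i'.
apply/mem_zeros => i /missingP iT; rewrite !mxE big1 // => i' /eqP wi; exact/vT/iT.
Qed.

Lemma dim_suppsp T : \dim (suppsp T) = #|T|.
Proof.
have card_missing q : (N - #|missing T q| = #|[set i | (i, q) \in T]|)%N.
  have -> : missing T q = ~: (w @: [set i | (i, q) \in T]).
    apply/setP => i; rewrite !inE; congr (~~ _);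
      apply/existsP/imsetP => [[i' /andP[/eqP <- iT]]|[i']].
      by exists i'; rewrite ?inE.
    by rewrite inE => iT ->; exists i'; rewrite eqxx.
  rewrite cardsCs setCK card_ord subKn; last by rewrite -[X in (_ <= X)%N]card_ord
    max_card.
  by rewrite card_imset // => i j /(congr1 val)/= e; apply: val_inj.
rewrite dim_colspace (eq_bigr (fun q => #|[set i | (i, q) \in T]|)) => [|q _];
  last by rewrite dim_zeros.
under eq_bigr => q _ do rewrite -sum1_card big_mkcond.
rewrite exchange_big pair_bigA -sum1_card [RHS]big_mkcond /=.
by apply: eq_bigr => -[i q] _; rewrite inE.
Qed.

Variables (x : 'M[F]_(N, a)) (y : 'M[F]_(n, b)).

Local Notation entry :=
  (rig_entry (fun (i : 'I_m) (j : 'I_a) => x (w i) j) (fun (k : 'I_n) (l : 'I_b) =>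
    y k l)).

(** The equations of the rows [inl (j, q)] are the entries of [x^T M = 0], those of the rows
    [inr (l, i)] the entries of [M y = 0]; the padding rows of [mxof v] are zero. *)
Lemma mem_nullsp_mxof T v : (forall c, c \notin T -> v c = 0) ->
  (mxof v \in nullsp x y (missing T)) <-> (forall r, \sum_(c in T) entry r c * v c = 0).
Proof.
move=> vT.
have sumT r : \sum_(c in T) entry r c * v c = \sum_i \sum_q entry r (i, q) * v (i, q).
  rewrite pair_bigA [RHS](bigID (mem T)) /= [X in _ + X]big1 ?addr0.
    by apply: eq_bigr => -[].
  by move=> c cT; rewrite -surjective_pairing (vT c) ?mulr0.
have xE j q : \sum_(c in T) entry (inl (j, q)) c * v c = (x^T *m col q (mxof v)) j 0.
  rewrite sumT mxE /=.
  under eq_bigr => i _.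
    rewrite (bigD1 q) //= eqxx big1 ?addr0; last by move=> p pq;
      rewrite (negPf pq) mul0r.
    rewrite -mxofE; over.
  rewrite [RHS](bigID (fun i => [exists i', w i' == i])) /= [X in _ + X]big1 ?addr0;
    last first.
    by move=> i /existsPn nwi; rewrite !mxE big1 ?mulr0 // => i' wi'; have := nwi i';
      rewrite wi'.
  rewrite -(big_imset (fun i => x i j * mxof v i q) (h := w) (A := predT)) /=;
    last first.
    by move=> i i' _ _ /(congr1 val) e; apply: val_inj.
  apply: eq_big => [i|i _]; last by rewrite !mxE.
  apply/imsetP/existsP => [[i' _ ->]|[i' /eqP <-]]; first by exists i'.
  by exists i'.
have yE l i : \sum_(c in T) entry (inr (l, i)) c * v c = (mxof v *m y) (w i) l.
  rewrite sumT mxE (bigD1 i) //= [X in _ + X]big1 ?addr0; last first.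
    by move=> i' ii'; rewrite big1 // => q _; rewrite (negPf ii') mul0r.
  by apply: eq_bigr => q _; rewrite eqxx mxofE mulrC.
rewrite memv_cap memv_ker rmulE; split.
  case/andP => /mem_colspace vO /eqP vy [[j q]|[l i]].
    have := vO q; rewrite memv_cap mem_orth => /andP[/eqP vx _].
    by rewrite xE vx mxE.
  by rewrite yE vy mxE.
move=> v0; apply/andP; split.
  apply/mem_colspace => q; rewrite memv_cap mem_orth; apply/andP; split.
    by apply/eqP/colP => j; rewrite -xE v0 mxE.
  by apply/(mem_colspace (fun q => zeros (missing T q)))/mem_suppsp; exists v.
apply/eqP/matrixP => i l; rewrite [RHS]mxE.
have [[i' <-]|nwi] := pselect (exists i', w i' = i); first by rewrite -yE v0.
rewrite mxE big1 // => q _; rewrite mxof0 ?mul0r // => i'.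
by apply/negP => /eqP wi; apply: nwi; exists i'.
Qed.

Lemma nullsp_supp T : (nullsp x y (missing T) <= suppsp T)%VS.
Proof.
apply/subvP => M; rewrite memv_cap => /andP[/mem_colspace MT _];
  apply/mem_colspace => q.
by have := MT q; rewrite memv_cap => /andP[].
Qed.

Lemma nullspS T T' : T \subset T' -> (nullsp x y (missing T) <=
  nullsp x y (missing T'))%VS.
Proof.
move=> TT'; apply: capvS => //; apply/subvP => M /mem_colspace MT;
  apply/mem_colspace => q.
have := MT q; rewrite !memv_cap => /andP[-> /mem_zeros Mz];
  apply/mem_zeros => i /missingP iT'.
by apply/Mz/missingP => i' /iT'; apply: contra; apply: (subsetP TT').
Qed.

(** For a largest independent [S] in [E], the space of matrices supported on [E] is the direct sum
    of those supported on [S] and of the relations on [E]. *)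
Lemma rank_nullity (E : {set J}) :
  (column_rank entry E + \dim (nullsp x y (missing E)) = #|E|)%N.
Proof.
have [S [SE Si rS]] := column_rankP entry E; rewrite rS.
pose delta c c' : F := (c' == c :> J)%:R.
have deltaE c : c \in E -> mxof (delta c) \in (suppsp S + nullsp x y (missing E))%VS.
  move=> cE; have [cS|cS] := boolP (c \in S).
    apply: subvP (addvSl _ _) _ _; apply/mem_suppsp; exists (delta c);
      split=> // c' c'S.
    by rewrite /delta; case: eqP c'S => // ->; rewrite cS.
  have cSE : c |: S \subset E by rewrite subUset sub1set cE SE.
  (* By maximality [c |: S] carries a nontrivial relation. Its coefficient at [c] is nonzero because
     [S] is independent, so the relation can be solved for [delta c]. *)
  have /column_indepP : ~~ column_indep entry (c |: S).
    apply/negP => /(leq_column_rank cSE); by rewrite rS cardsU1 cS ltnn.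
  move=> /existsNP[v /not_implyP[v0 /existsNP[c0 /not_implyP[c0S vc0]]]].
  pose u c' := if c' \in S then v c' else 0.
  have uS c' : c' \notin S -> u c' = 0 by rewrite /u => /negPf->.
  pose v' c' := v c * delta c c' + u c'.
  have v'E c' : c' \in c |: S -> v' c' = v c'.
    rewrite /v' /u /delta inE in_set1; case: eqP => [-> _|_ /= ->].
      by rewrite (negPf cS) mulr1 addr0.
    by rewrite mulr0 add0r.
  have v'0 r : \sum_(c' in c |: S) entry r c' * v' c' = 0.
    by rewrite -[RHS](v0 r); apply: eq_bigr => c' /v'E->.
  have vc : v c != 0.
    apply/eqP => vc; apply: vc0; move: c0S; rewrite in_setU1 => /predU1P[-> //|].
    apply: (column_indepP _ _ Si v) => r; rewrite -[RHS](v0 r) big_setU1 //=.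
    by rewrite vc mulr0 add0r.
  have : mxof v' \in nullsp x y (missing E).
    apply: (subvP (nullspS cSE)); apply/mem_nullsp_mxof => // c'.
    rewrite in_setU1 negb_or => /andP[c'c c'S].
    by rewrite /v' (uS _ c'S) /delta (negPf c'c) mulr0 addr0.
  rewrite mxof_linear => memN.
  have -> : mxof (delta c) = (v c)^-1 *: (- mxof u + (v c *: mxof (delta c) + mxof u)).
    by rewrite addrC addrK scalerA mulVf // scale1r.
  apply/memvZ/memv_add => //; rewrite rpredN; apply/mem_suppsp; by exists u.
rewrite -(dim_suppsp S) -(dim_suppsp E) -dimv_disjoint_sum.
  congr (\dim _); apply/eqP; rewrite eqEsubv subv_add nullsp_supp andbT; apply/andP;
    split.
    apply/subvP => _ /mem_suppsp[v [vS ->]]; apply/mem_suppsp; exists v;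
      split=> // c cE.
    by apply: vS; apply: contra cE; apply: (subsetP SE).
  apply/subvP => _ /mem_suppsp[v [vE ->]].
  have -> : mxof v = \sum_(c in E) v c *: mxof (delta c).
    apply/matrixP => i q; rewrite mxE summxE.
    under [RHS]eq_bigr => c _ do rewrite !mxE mulr_sumr.
    rewrite exchange_big; apply: eq_bigr => i' _ /=.
    have [iE|iE] := boolP ((i', q) \in E); last first.
      rewrite vE // big1 // => c cE; rewrite /delta (_ : _ == c = false) ?mulr0 //.
      by apply: contraNF iE => /eqP->.
    rewrite (bigD1 (i', q)) //= /delta eqxx mulr1 big1 ?addr0 // => c /andP[_ ci].
    by rewrite eq_sym (negPf ci) mulr0.
  by rewrite rpred_sum // => c cE; rewrite memvZ // deltaE.
apply/eqP; rewrite -subv0; apply/subvP => _ /memv_capP[/mem_suppsp[v [vS ->]]].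
have vE c : c \notin E -> v c = 0 by move=> cE; apply: vS; apply: contra cE;
  apply: (subsetP SE).
move/(mem_nullsp_mxof vE) => v0; rewrite memv0; apply/eqP/matrixP => i q;
  rewrite !mxE big1 // => i' _.
have [iS|/vS //] := boolP ((i', q) \in S); apply: (column_indepP _ _ Si) iS => r.
rewrite -[RHS](v0 r) [RHS](big_setID S) /= (setIidPr SE) [X in _ + X]big1 ?addr0 // =>
  c.
by rewrite inE => /andP[/vS-> _]; rewrite mulr0.
Qed.

End Bridge.

(** * The rank over the field of indeterminates *)

Section RankFormula.
Variables (F : fieldType) (m n a b : nat) (ma : (m <= a.+3)%N).
Hypothesis F_infinite : forall p : {poly F}, p != 0 -> exists t, p.[t] != 0.
Variable E : {set 'I_m * 'I_n}.

(** The nullity bound holds over every field and for all [x] and [y], hence for the matrices of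
    indeterminates. *)
Lemma rigidity_rank_upper i j k l c : c \in null_bound b (missing ma E) i j k l ->
  (rigidity_rank F a b E + c <= #|E|)%N.
Proof.
move=> cb; pose K := rigidity_field F m n a b.
(* For [m < a + 3] the added rows of [x] are zero; they only meet the empty rows of [E]. *)
pose x : 'M[K]_(a.+3, a) :=
  \matrix_(i, j) if insub (val i) is Some i' then xvar F n b i' j else 0.
pose y : 'M[K]_(n, b) := \matrix_(k, l) yvar F m a k l.
rewrite -(rank_nullity ma x y E).
have -> : (fun i j => x (widen_ord ma i) j) = @xvar F m n a b.
  by apply/funext => i'; apply/funext => j'; rewrite mxE /= valK.
have -> : (fun k l => y k l) = @yvar F m n a b.
  by apply/funext => i'; apply/funext => j'; rewrite mxE.
rewrite leq_add2l; apply: null_bound_lower cb.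
by apply: leq_trans (dim_orth x); lia.
Qed.

(** Special [x] and [y] over [F] attain the bound, and passing from special values to indeterminates
    cannot lower the rank. *)
Lemma rigidity_rank_lower : exists i j k l, exists2 c,
  c \in null_bound b (missing ma E) i j k l & (#|E| <= rigidity_rank F a b E + c)%N.
Proof.
have [x xgen] := exists_generic a F_infinite; have [dO _ _] := xgen.
have [y [W [WO Nle]]] := exists_nullsp_eq b F_infinite (missing ma E) (ltn0Sn _) dO.
have [i [j [k [l [c cb Nc]]]]] := null_bound_upper xgen WO Nle.
exists i, j, k, l, c => //; rewrite -(rank_nullity ma x y E) leq_add //.
have [S [SE Si ->]] := column_rankP (rig_entry (fun i j => x (widen_ord ma i) j) (fun k
  l => y k l)) E.
exact/leq_column_rank/(column_indep_specialize Si).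
Qed.

(* #|E| - max c is the number of s < #|E| such that all c are at most s. *)
Lemma rigidity_rankE : rigidity_rank F a b E =
  (\sum_(s < #|E|) (1 - \sum_(i < a.+3) \sum_(j < a.+3) \sum_(k < a.+3) \sum_(l < a.+3)
     \sum_(c <- null_bound b (missing ma E) i j k l) (c - s)))%N.
Proof.
set r := rigidity_rank F a b E.
have rE : (r <= #|E|)%N.
  have := @rigidity_rank_upper ord0 ord0 ord0 ord0 _ (mem_head _ _).
  by apply: leq_trans; rewrite leq_addr.
transitivity (\sum_(s < #|E|) (#|E| - r <= s))%N.
  rewrite -(big_mkord xpredT (fun s => nat_of_bool (#|E| - r <= s)%N)) (@big_cat_nat _
    _ _ (#|E| - r)%N) //=; last exact: leq_subr.
  rewrite big1_seq => [|s /andP[_]]; last by rewrite mem_index_iota => /andP[_ sl];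
    rewrite leqNgt sl.
  rewrite (eq_big_nat _ _ (F2 := fun=> 1%N)) => [|s /andP[-> _] //].
  by rewrite sum_nat_const_nat muln1 add0n subKn.
apply: eq_bigr => s _; set sum := (X in (1 - X)%N).
(* By the two bounds the largest [c] is [#|E| - r], so the inner sum vanishes exactly when
   [#|E| - r <= s]. *)
suff -> : (#|E| - r <= s)%N = (sum == 0)%N by case: sum.
apply/idP/idP => [le|sum0].
  rewrite /sum; apply/eqP; do 4!(apply: big1 => ? _); rewrite big1_seq // => c /= cb.
  apply/eqP; rewrite subn_eq0; apply: leq_trans le.
  by have := rigidity_rank_upper cb; rewrite -/r; lia.
have [i [j [k [l [c cb Ec]]]]] := rigidity_rank_lower.
have : (c - s = 0)%N.
  apply/eqP; rewrite -leqn0 -(eqP sum0) /sum.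
  rewrite (bigD1 i) //= (bigD1 j) //= (bigD1 k) //= (bigD1 l) //= (big_rem c) //=.
  by rewrite -!addnA leq_addr.
by rewrite -/r in Ec; lia.
Qed.

End RankFormula.

Lemma numField_infinite (F : numFieldType) (p : {poly F}) : p != 0 -> exists t,
  p.[t] != 0.
Proof.
move=> p0; apply: contrapT => /forallNP roots.
have := @max_poly_roots F p [seq i%:R | i <- iota 0 (size p)] p0.
rewrite size_map size_iota ltnn => H; case/negP: (negbT (erefl false)).
apply: H; last by rewrite map_inj_uniq ?iota_uniq // => i j /eqP;
  rewrite Num.Theory.eqr_nat => /eqP.
by apply/allP => t _; apply: contrapT => /negP; apply: roots.
Qed.

Local Close Scope ring_scope.

(** * Structured programs *)

(* Relocatable code: the instructions as a function of the address of the first one. *)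
Definition code := nat -> seq instr.

(** Quantifying over the surrounding code makes this compositional: execution enters at the first
    instruction and leaves just after the last. *)
Definition runs (c : code) (s s' : memory) (T : nat) : Prop :=
  forall P1 P2, exists2 t, t <= T &
    iter t (step (P1 ++ c (size P1) ++ P2)) (Config (size P1) s)
    = Config (size P1 + size (c (size P1))) s'.

Definition ins (i : instr) : code := fun=> [:: i].

Definition seqc (c1 c2 : code) : code :=
  fun o => c1 o ++ c2 (o + size (c1 o)).

(** The machine has only a conditional jump, so an unconditional one first sets the scratch register
    [z] to 1. The code for [x = 0] comes first; the offset 3 counts the test and the jump over
    [b1]. *)
Definition ifc (x z : nat) (c1 c2 : code) : code := fun o =>
  let b2 := c2 o.+1 in
  let b1 := c1 (o + (size b2).+3) in
  JumpPos x (o + (size b2).+3) :: b2 ++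
  [:: Const z 1; JumpPos z (o + (size b2).+3 + size b1)] ++ b1.

(** The test stands at the end of the loop and is first reached by a jump. *)
Definition whilec (x z : nat) (c : code) : code := fun o =>
  let b := c o.+2 in
  [:: Const z 1; JumpPos z (o.+2 + size b)] ++ b ++ [:: JumpPos x o.+2].

Lemma step_at P1 i P2 P p s : P = P1 ++ i :: P2 -> p = size P1 ->
  step P (Config p s) = exec i (Config p s).
Proof. by move=> -> ->; rewrite /step onth_cat ltnn subnn. Qed.

Lemma runs_le c s s' T T' : T <= T' -> runs c s s' T -> runs c s s' T'.
Proof. by move=> TT' H P1 P2; have [t tT e] := H P1 P2; exists t => //;
  apply: leq_trans TT'. Qed.

Lemma runs_ins i s s' :
  (forall p, exec i (Config p s) = Config p.+1 s') -> runs (ins i) s s' 1.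
Proof.
by move=> ex P1 P2; exists 1 => //=; rewrite (step_at _ (P1 := P1) (i := i) (P2 := P2))
  // ex addn1.
Qed.

Lemma runs_const r v s : runs (ins (Const r v)) s (upd s r v) 1.
Proof. exact: runs_ins. Qed.

Lemma runs_add i j k s : runs (ins (Add i j k)) s (upd s i (s j + s k)) 1.
Proof. exact: runs_ins. Qed.

Lemma runs_sub i j k s : runs (ins (Defs.Sub i j k)) s (upd s i (s j - s k)) 1.
Proof. exact: runs_ins. Qed.

Lemma runs_fetch i j s : runs (ins (Fetch i j)) s (upd s i (s (s j))) 1.
Proof. exact: runs_ins. Qed.

Lemma runs_store i j s : runs (ins (Store i j)) s (upd s (s i) (s j)) 1.
Proof. exact: runs_ins. Qed.

Lemma runs_seq c1 c2 s s1 s2 T1 T2 :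
  runs c1 s s1 T1 -> runs c2 s1 s2 T2 -> runs (seqc c1 c2) s s2 (T1 + T2).
Proof.
move=> H1 H2 P1 P2; set b1 := c1 (size P1).
have sz : size (P1 ++ b1) = size P1 + size b1 by rewrite size_cat.
have [t1 t1T e1] := H1 P1 (c2 (size P1 + size b1) ++ P2).
have [t2 t2T] := H2 (P1 ++ b1) P2; rewrite sz -?catA => e2.
exists (t2 + t1); first by rewrite addnC leq_add.
by rewrite iterD /seqc /= -?catA e1 e2 size_cat addnA.
Qed.

Lemma runs_if x z c1 c2 s s1 T :
    runs (if 0 < s x then c1 else c2) s s1 T ->
  exists2 s', runs (ifc x z c1 c2) s s' (T + 3) & forall i, i != z -> s' i = s1 i.
Proof.
move=> H; exists (if 0 < s x then s1 else upd s1 z 1); last first.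
  by move=> i iz; case: ifP => // _; rewrite /upd (negPf iz).
move=> P1 P2; rewrite /ifc; set b2 := c2 _; pose o1 := size P1 + (size b2).+3.
rewrite -/o1; set b1 := c1 o1; set e1 := o1 + size b1; set b := _ :: _.
pose b' := JumpPos x o1 :: b2 ++ [:: Const z 1; JumpPos z e1].
have szb' : size (P1 ++ b') = o1 by rewrite !size_cat /= size_cat /= /o1; lia.
have szb : size P1 + size b = e1 by rewrite /b /= !size_cat /= /e1 /o1; lia.
set P := P1 ++ b ++ P2; rewrite szb.
have st0 s0 : step P (Config (size P1) s0) = exec (JumpPos x o1) (Config (size P1) s0).
  exact: (@step_at P1 (JumpPos x o1) ((b2 ++ [:: Const z 1, JumpPos z e1 & b1]) ++ P2)).
have st1 s0 : step P (Config ((size P1).+1 + size b2) s0) = Config ((size P1).+1 +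
  size b2).+1 (upd s0 z 1).
  apply: (@step_at (P1 ++ JumpPos x o1 :: b2) (Const z 1) (JumpPos z e1 :: b1 ++ P2)).
    by rewrite /P /b -?catA /= -?catA.
  by rewrite size_cat /= addnS.
have st2 s0 : step P (Config ((size P1).+1 + size b2).+1 (upd s0 z 1)) =
  Config e1 (upd s0 z 1).
  rewrite (@step_at (P1 ++ JumpPos x o1 :: b2 ++ [:: Const z 1]) (JumpPos z e1) (b1 ++
    P2)).
  - by rewrite /exec /upd eqxx.
  - by rewrite /P /b -?catA /= -?catA.
  - by rewrite !size_cat /= size_cat /=; lia.
case: ifP H => sx H.
  have [t tT] := H (P1 ++ b') P2; rewrite szb' -/b1 => e; exists (t + 1); first by lia.
  rewrite iterD /= st0 /exec sx -e; congr (iter t (step _) _).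
  by rewrite /P /b /b' -?catA /= -?catA.
have [t tT] := H (rcons P1 (JumpPos x o1)) ([:: Const z 1; JumpPos z e1] ++ b1 ++ P2).
rewrite size_rcons -/b2 cat_rcons => e; exists (2 + (t + 1)); first by lia.
rewrite iterD iterD /= st0 /exec sx (_ : iter t _ _ = Config ((size P1).+1 +
  size b2) s1) ?st1 ?st2 //.
by rewrite -e; congr (iter t (step _) _); rewrite /P /b -?catA /= -?catA.
Qed.

(** The states are those at the test, and each test counts one step. *)
Inductive loops (c : code) (x : nat) : memory -> memory -> nat -> Prop :=
| LoopsDone s : s x = 0 -> loops c x s s 1
| LoopsNext s s1 s2 T T' : 0 < s x -> runs c s s1 T -> loops c x s1 s2 T' ->
    loops c x s s2 (1 + T + T').

Lemma runs_while x z c s s' T :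
  loops c x (upd s z 1) s' T -> runs (whilec x z c) s s' (2 + T).
Proof.
move=> H P1 P2; set o := size P1; rewrite /whilec -/o; set b := c _.
set P := _ ++ _ ++ P2.
have stA s0 : step P (Config o s0) = Config o.+1 (upd s0 z 1).
  by rewrite (@step_at P1 (Const z 1) (JumpPos z (o.+2 + size b) :: b ++
    JumpPos x o.+2 :: P2)) // /P /= -catA.
have stB s0 : step P (Config o.+1 (upd s0 z 1)) = Config (o.+2 + size b) (upd s0 z 1).
  rewrite (@step_at (rcons P1 (Const z 1)) (JumpPos z (o.+2 + size b)) (b ++
    JumpPos x o.+2 :: P2)).
  - by rewrite /exec /upd eqxx.
  - by rewrite /P cat_rcons /= -catA.
  - by rewrite size_rcons.
have stC s0 : step P (Config (o.+2 + size b) s0) = Config (if 0 < s0 x then o.+2 else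
  (o.+2 + size b).+1) s0.
  rewrite (@step_at (P1 ++ [:: Const z 1, JumpPos z (o.+2 + size b) & b]) (JumpPos x
    o.+2) P2) //.
  - by rewrite /P -!catA.
  - by rewrite size_cat /= -/o !addnS.
have L s0 : loops c x s0 s' T -> exists2 t, t <= T & iter t (step P) (Config (o.+2 +
  size b) s0) = Config (o.+2 + size b).+1 s'.
  elim => {s0 s' T H} [s0 s0x|s0 s1 s2 T T' s0x r _ [t' t'T e']].
    by exists 1 => //=; rewrite stC s0x.
  have [t tT] := r (P1 ++ [:: Const z 1; JumpPos z (o.+2 + size b)]) ([::
    JumpPos x o.+2] ++ P2).
  rewrite size_cat /= addn2 -/o -/b => e.
  exists (t' + (t + 1)); first by lia.
  rewrite iterD iterD /= stC s0x; rewrite (_ : iter t (step P) _ = Config (o.+2 +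
    size b) s1) //.
  by rewrite -e /P -?catA.
have [t tT e] := L _ H; exists (t + 2); first by lia.
rewrite iterD /= stA stB e; congr Config; rewrite !size_cat /= addnS addn1; lia.
Qed.

(* Var i is the i-th variable of the environment, counted from the outside;
   Sum e f binds one more variable, ranging over [0, e), in f. *)
Inductive expr :=
| Var of nat
| Num of nat
| Plus of expr & expr
| Minus of expr & expr
| Read of expr
| Sum of expr & expr.

Fixpoint eval (h : nat -> nat) (env : seq nat) (e : expr) : nat :=
  match e with
  | Var i => nth 0 env i
  | Num c => c
  | Plus e1 e2 => eval h env e1 + eval h env e2
  | Minus e1 e2 => eval h env e1 - eval h env e2
  | Read e1 => h (eval h env e1)
  | Sum e1 e2 => \sum_(v < eval h env e1) eval h (rcons env v) e2
  end.

(** The constants count the instructions emitted by [compile]. For a sum, 6 is three instructions of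
    initialisation, two to enter the loop and the last test; each pass adds three instructions and
    one test. *)
Fixpoint cost (h : nat -> nat) (env : seq nat) (e : expr) : nat :=
  match e with
  | Var _ => 2
  | Num _ => 1
  | Plus e1 e2 | Minus e1 e2 => cost h env e1 + cost h env e2 + 1
  | Read e1 => cost h env e1 + 3
  | Sum e1 e2 =>
      cost h env e1 + 6 + \sum_(v < eval h env e1) (cost h (rcons env v) e2 + 4)
  end.

(** * Compilation of expressions *)

Section Compile.
(* Variables live in the registers below tmp, temporaries in [tmp, heap). *)
Variables (tmp heap : nat).

(** [k] is the number of variables in scope, hence the register of the next one, and [d] receives
    the result. The variable of a sum is itself the loop counter: decremented before the body, it
    runs through its range downwards. *)
Fixpoint compile (k d : nat) (e : expr) : code :=
  match e with
  | Var i => seqc (ins (Const d 0)) (ins (Add d d i))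
  | Num c => ins (Const d c)
  | Plus e1 e2 => seqc (seqc (compile k d e1) (compile k d.+1 e2)) (ins (Add d d d.+1))
  | Minus e1 e2 => seqc (seqc (compile k d e1) (compile k d.+1 e2)) (ins (Defs.Sub d d
    d.+1))
  | Read e1 => seqc (compile k d e1)
      (seqc (ins (Const d.+1 heap)) (seqc (ins (Add d d d.+1)) (ins (Fetch d d))))
  | Sum e1 e2 => seqc (compile k d e1)
      (seqc (ins (Const k 0)) (seqc (ins (Add k k d)) (seqc (ins (Const d 0))
        (whilec k d.+1 (seqc (ins (Const d.+1 1)) (seqc (ins (Defs.Sub k k d.+1))
          (seqc (compile k.+1 d.+1 e2) (ins (Add d d d.+1)))))))))
  end.

Fixpoint fits (k d : nat) (e : expr) : bool :=
  match e with
  | Var i => (i < k) && (d < heap)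
  | Num _ => d < heap
  | Plus e1 e2 | Minus e1 e2 => [&& d < heap, fits k d e1 & fits k d.+1 e2]
  | Read e1 => (d.+1 < heap) && fits k d e1
  | Sum e1 e2 => [&& k < tmp, d.+1 < heap, fits k d e1 & fits k.+1 d.+1 e2]
  end.

Definition frame (k d : nat) (s s' : memory) :=
  forall i, [|| i < k, tmp <= i < d | heap <= i] -> s' i = s i.

Lemma compileP h e k d env s :
    fits k d e -> size env = k -> k <= tmp <= d ->
    (forall i, i < k -> s i = nth 0 env i) -> (forall p, s (heap + p) = h p) ->
  exists s', [/\ runs (compile k d e) s s' (cost h env e), s' d = eval h env e & frame
    k d s s'].
Proof.
elim: e k d env s => [i|c|e1 IH1 e2 IH2|e1 IH1 e2 IH2|e1 IH1|e1 IH1 e2 IH2] k d env s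
  /=.
- move=> /andP[ik dh] szk /andP[kt td] senv sh; eexists; split.
  + exact: (runs_seq (runs_const _ _ _) (runs_add _ _ _ _)).
  + by rewrite /upd eqxx (_ : i == d = false) ?senv //; lia.
  + by move=> j jP; rewrite /upd (_ : j == d = false) //; lia.
- move=> dh szk /andP[kt td] senv sh; eexists; split; first exact: runs_const.
    by rewrite /upd eqxx.
  by move=> j jP; rewrite /upd (_ : j == d = false) //; lia.
- move=> /and3P[dh f1 f2] szk /andP[kt td] senv sh.
  have [|s1 [r1 v1 fr1]] := IH1 k d env s f1 szk _ senv sh; first by rewrite kt.
  have [|||s2 [r2 v2 fr2]] := IH2 k d.+1 env s1 f2 szk; try lia.
  + by move=> i ik; rewrite fr1 ?senv // ik.
  + by move=> p; rewrite fr1 ?sh //; lia.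
  eexists; split; first exact: (runs_seq (runs_seq r1 r2) (runs_add _ _ _ _)).
  + by rewrite /upd eqxx v2 fr2 ?v1 //; lia.
  + by move=> j jP; rewrite /upd (_ : j == d = false) ?fr2 ?fr1 //; lia.
- move=> /and3P[dh f1 f2] szk /andP[kt td] senv sh.
  have [|s1 [r1 v1 fr1]] := IH1 k d env s f1 szk _ senv sh; first by rewrite kt.
  have [|||s2 [r2 v2 fr2]] := IH2 k d.+1 env s1 f2 szk; try lia.
  + by move=> i ik; rewrite fr1 ?senv // ik.
  + by move=> p; rewrite fr1 ?sh //; lia.
  eexists; split; first exact: (runs_seq (runs_seq r1 r2) (runs_sub _ _ _ _)).
  + by rewrite /upd eqxx v2 fr2 ?v1 //; lia.
  + by move=> j jP; rewrite /upd (_ : j == d = false) ?fr2 ?fr1 //; lia.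
- move=> /andP[dh f1] szk /andP[kt td] senv sh.
  have [|s1 [r1 v1 fr1]] := IH1 k d env s f1 szk _ senv sh; first by rewrite kt.
  eexists; split.
  + exact: (runs_seq r1 (runs_seq (runs_const _ _ _) (runs_seq (runs_add _ _ _ _)
    (runs_fetch _ _ _)))).
  + rewrite /upd !eqxx (_ : d == d.+1 = false) ?v1; last by lia.
    by rewrite !ifF -?sh ?fr1 1?addnC //; lia.
  + move=> j jP; rewrite /upd (_ : j == d = false); last by lia.
    by rewrite (_ : j == d.+1 = false) ?fr1 //; lia.
move=> /and4P[kt' dh f1 f2] szk /andP[kt td] senv sh.
have [|s1 [r1 v1 fr1]] := IH1 k d env s f1 szk _ senv sh; first by rewrite kt.
pose s2 := upd (upd (upd (upd s1 k 0) k (upd s1 k 0 k + upd s1 k 0 d)) d 0) d.+1 1.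
set body := seqc (ins (Const d.+1 1)) _.
(* Induction on the counter: a pass that starts at [x.+1] adds the last summand, with variable [x],
   and leaves a sum over [x] values. *)
have L x s0 : s0 k = x -> frame k d s s0 ->
    exists s', [/\ loops body k s0 s' (1 + \sum_(v < x) (cost h (rcons env v) e2 + 4)),
      s' d = s0 d + \sum_(v < x) eval h (rcons env v) e2 & frame k d s s'].
  elim: x s0 => [|x IHx] s0 s0k fr.
    by exists s0; rewrite !big_ord0 !addn0; split=> //; apply: LoopsDone.
  pose s3 := upd (upd s0 d.+1 1) k (upd s0 d.+1 1 k - upd s0 d.+1 1 d.+1).
  have s3k : s3 k = x by rewrite /s3 /upd !eqxx s0k (_ : k == d.+1 = false) ?subn1 //;
    lia.
  have [||||s4 [r4 v4 fr4]] := IH2 k.+1 d.+1 (rcons env x) s3 f2;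
    try by rewrite ?size_rcons ?szk //; lia.
  + move=> i; rewrite ltnS leq_eqVlt nth_rcons szk => /predU1P[->|ik];
    first by rewrite ltnn eqxx.
    rewrite ik /s3 /upd !ifF ?fr ?senv // ?ik //; lia.
  + by move=> p; rewrite /s3 /upd !ifF ?fr ?sh //; lia.
  pose s5 := upd s4 d (s4 d + s4 d.+1).
  have [||s' [r' v' fr']] := IHx s5.
  + by rewrite /s5 /upd (_ : k == d = false) ?fr4 ?s3k //; lia.
  + move=> i iP; rewrite /s5 /upd (_ : i == d = false) ?fr4 ?/s3 /upd; try lia.
    by rewrite !ifF ?fr //; lia.
  exists s'; split=> //; last first.
    have s5d : s5 d = s0 d + eval h (rcons env x) e2.
      by rewrite /s5 {1}/upd eqxx v4 fr4; [rewrite /s3 /upd !ifF //; lia | lia].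
    by rewrite v' s5d big_ord_recr /= -addnA [X in _ + X]addnC.
  have TE S c : 1 + (S + (c + 4)) = 1 + (1 + (1 + (c + 1))) + (1 + S) by lia.
  rewrite big_ord_recr /= TE.
  apply: LoopsNext r'; first by rewrite s0k.
  exact: (runs_seq (runs_const _ _ _) (runs_seq (runs_sub _ _ _ _) (runs_seq r4
    (runs_add _ _ _ _)))).
have s2k : s2 k = eval h env e1.
  by rewrite /s2 /upd !eqxx !ifF ?v1 //; lia.
have [|s' [r' v' fr']] := L _ s2 s2k.
  by move=> i iP; rewrite /s2 /upd !ifF ?fr1 //; lia.
exists s'; split=> //; last first.
  by rewrite v' /s2 /upd eqxx ifF //; lia.
have TE S c : c + 6 + S = c + (1 + (1 + (1 + (2 + (1 + S))))) by lia.
rewrite TE.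
exact: (runs_seq r1 (runs_seq (runs_const _ _ _) (runs_seq (runs_add _ _ _ _)
  (runs_seq (runs_const _ _ _) (runs_while r'))))).
Qed.

End Compile.

(** * Polynomial bounds for values and costs *)

Section PolynomialTime.
Local Open Scope ring_scope.
Implicit Types (benv : seq {poly nat}) (N : nat).

(** [Read] is bounded by 1 because the cells hold bits; the variable of a sum inherits the bound of
    its range. *)
Fixpoint eval_bound benv (e : expr) : {poly nat} :=
  match e with
  | Var i => nth 0 benv i
  | Num c => c%:P
  | Plus e1 e2 => eval_bound benv e1 + eval_bound benv e2
  | Minus e1 _ => eval_bound benv e1
  | Read _ => 1
  | Sum e1 e2 => let b := eval_bound benv e1 in b * eval_bound (rcons benv b) e2
  end.

Fixpoint cost_bound benv (e : expr) : {poly nat} :=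
  match e with
  | Var _ => 2%:P
  | Num _ => 1%:P
  | Plus e1 e2 | Minus e1 e2 => cost_bound benv e1 + cost_bound benv e2 + 1%:P
  | Read e1 => cost_bound benv e1 + 3%:P
  | Sum e1 e2 => let b := eval_bound benv e1 in
      cost_bound benv e1 + 6%:P + b * (cost_bound (rcons benv b) e2 + 4%:P)
  end.

Lemma horner_le_bounds (h : nat -> nat) e env benv N :
    (forall p, h p <= 1)%N -> (size env = size benv) ->
    (forall i, nth 0 env i <= (nth 0%R benv i).[N]%R)%N ->
  (eval h env e <= (eval_bound benv e).[N]%R)%N /\
  (cost h env e <= (cost_bound benv e).[N]%R)%N.
Proof.
move=> h1; elim: e env benv => [i|c|e1 IH1 e2 IH2|e1 IH1 e2 IH2|e1 IH1|e1 IH1 e2 IH2]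
  env benv sz le /=.
- by rewrite hornerC; split.
- by rewrite !hornerC; split.
- have [v1 c1] := IH1 _ _ sz le; have [v2 c2] := IH2 _ _ sz le.
  by rewrite !(hornerD, hornerM, hornerC); split; rewrite ?leq_add.
- have [v1 c1] := IH1 _ _ sz le; have [v2 c2] := IH2 _ _ sz le.
  by rewrite !(hornerD, hornerM, hornerC); split; rewrite ?leq_add //;
    apply: leq_trans v1; apply: leq_subr.
- have [v1 c1] := IH1 _ _ sz le.
  by rewrite !(hornerD, hornerM, hornerC); split; [exact: h1 | apply: leq_add].
have [v1 c1] := IH1 _ _ sz le; rewrite !(hornerD, hornerM, hornerC).
have ext v : (v < eval h env e1)%N -> 
  (eval h (rcons env v) e2 <= (eval_bound (rcons benv (eval_bound benv e1))
    e2).[N]%R)%N /\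
  (cost h (rcons env v) e2 <= (cost_bound (rcons benv (eval_bound benv e1))
    e2).[N]%R)%N.
  move=> lt; apply: IH2; first by rewrite !size_rcons sz.
  move=> i; rewrite !nth_rcons sz; case: ltngtP => // _.
  exact: leq_trans (ltnW lt) v1.
split.
  apply: leq_trans (leq_mul v1 (leqnn _)).
  rewrite -[X in (_ <= X * _)%N]card_ord -sum_nat_const; apply: leq_sum => v _.
  by case: (ext v).
apply: leq_add; first by rewrite leq_add.
apply: leq_trans (leq_mul v1 (leqnn _)).
rewrite -[X in (_ <= X * _)%N]card_ord -sum_nat_const; apply: leq_sum => v _.
by rewrite leq_add2r; case: (ext v).
Qed.

End PolynomialTime.

(** * Relocation of the first input cells *)

Section Prologue.
(* The registers 4, 5, ... initially hold input cells.  To free the registers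
   below heap, the finite control remembers their contents and then writes them
   beyond all the cells that are read later. *)
Variables (tmp heap : nat).
Hypothesis tmp5 : 5 <= tmp.
Hypothesis tmp_heap : tmp.+2 < heap.

(** A decision tree on input bits, where [bs] lists those already tested. Its [2^k] leaves are a
    constant number, as the depth used depends only on [heap]. *)
Fixpoint branch (leaf : seq nat -> code) (bs : seq nat) (k : nat) : code :=
  if k is k'.+1 then
    ifc (4 + size bs) tmp (branch leaf (rcons bs 1) k') (branch leaf (rcons bs 0) k')
  else leaf bs.

Lemma runs_branch leaf k bs s s1 T :
    (forall i, i < k -> s (4 + size bs + i) <= 1) ->
    runs (leaf (bs ++ [seq s (4 + size bs + i) | i <- iota 0 k])) s s1 T ->
  exists2 s', runs (branch leaf bs k) s s' (T + 3 * k) & forall i, i != tmp -> s' i =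
    s1 i.
Proof.
elim: k bs T => [|k IHk] bs T bit r.
  by exists s1; rewrite ?muln0 ?addn0 //; rewrite cats0 in r.
have s0 : s (4 + size bs) = nat_of_bool (0 < s (4 + size bs)).
  by have := bit 0 isT; rewrite addn0; case: (s _) => [|[]].
have [||s' r' s'P] := IHk (rcons bs (s (4 + size bs))) T.
- by move=> i ik; rewrite size_rcons; have := bit i.+1 ik; rewrite addnS addnS.
- rewrite size_rcons cat_rcons; move: r; rewrite /= addn0.
  rewrite -[in X in runs (leaf (bs ++ _ :: [seq _ | i <- X])) _](addn0 1) iotaDl
    -map_comp.
  by under eq_map => i do rewrite /= addnA addn1 -addnS.
have [|s'' r'' s''P] := @runs_if (4 + size bs) tmp (branch leaf (rcons bs 1) k) (branch
  leaf (rcons bs 0) k) s s' (T + 3 * k).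
  by move: r'; rewrite {1}s0; case: (0 < _).
exists s''; first by rewrite mulnS addnCA addnC.
by move=> i it; rewrite s''P // s'P.
Qed.

(** Register 4 contains the offset of the target in the heap; [tmp] takes the address and [tmp.+1]
    the bit. *)
Fixpoint stash (j : nat) (bs : seq nat) : code :=
  if bs is b :: bs' then
    seqc (seqc (ins (Const tmp (heap + j))) (seqc (ins (Add tmp tmp 4))
      (seqc (ins (Const tmp.+1 b)) (ins (Store tmp tmp.+1))))) (stash j.+1 bs')
  else fun=> [::].

Lemma runs_nil s : runs (fun=> [::]) s s 0.
Proof. by move=> P1 P2; exists 0 => //=; rewrite addn0. Qed.

Lemma runs_stash j bs s : exists s', [/\ runs (stash j bs) s s' (4 * size bs),
  forall i, i < size bs -> s' (heap + (s 4 + j + i)) = nth 0 bs i &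
  forall r, r < tmp \/ heap <= r /\ (r < heap + (s 4 + j) \/ heap + (s 4 + j +
    size bs) <= r) -> s' r = s r].
Proof.
elim: bs j s => [|b bs IHbs] j s /=; first by exists s; split=> //; apply: runs_nil.
pose s1 := upd s tmp (heap + j).
pose s2 := upd s1 tmp (s1 tmp + s1 4).
pose s3 := upd s2 tmp.+1 b.
pose s4 := upd s3 (s3 tmp) (s3 tmp.+1).
have r4 : runs (seqc (ins (Const tmp (heap + j))) (seqc (ins (Add tmp tmp 4))
      (seqc (ins (Const tmp.+1 b)) (ins (Store tmp tmp.+1))))) s s4 (1 + (1 + (1 + 1))).
  exact: (runs_seq (runs_const _ _ _) (runs_seq (runs_add _ _ _ _) (runs_seq
    (runs_const _ _ _) (runs_store _ _ _)))).
have s3t : s3 tmp = heap + (s 4 + j).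
  by rewrite /s3 /s2 /s1 /upd eqxx !ifF //; lia.
have s44 : s4 4 = s 4 by rewrite /s4 s3t /s3 /s2 /s1 /upd !ifF //; lia.
have [s' [r' v' fr']] := IHbs j.+1 s4; exists s'; split.
- by rewrite mulnS; apply: runs_seq r4 r'.
- move=> [_|i] /=.
    rewrite fr'; last by right; rewrite s44; lia.
    by rewrite /s4 s3t /upd addn0 eqxx /s3 /upd eqxx.
  by rewrite ltnS => /v'; rewrite s44 !addnS.
move=> r rP; rewrite fr'; last by rewrite s44; lia.
by rewrite /s4 s3t /s3 /s2 /s1 /upd !ifF //; lia.
Qed.

End Prologue.

(** * The program computing the rank *)

Section RankProgram.
Variables (tmp heap : nat).
Local Notation kappa := (heap - 4).

(* The environment is m, n, a, b, H, where H is the offset in the heap of the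
   relocated cells, followed by s, i, j, k, l, q, r. *)
Definition rows := Plus (Var 2) (Num 3).

(** The product of row number and [n] is written as a sum. Position [p] of the incidence matrix
    comes in register [4 + p], which is heap cell [p - kappa] if [p >= kappa]; otherwise it has been
    moved to heap cell [H + p]. A sum over a range of size 0 or 1 distinguishes the cases. *)
Definition cell r q :=
  let p := Plus (Sum (Var r) (Var 1)) (Var q) in
  Read (Plus (Minus p (Num kappa))
    (Sum (Minus (Num 1) (Minus (Num 1) (Minus (Num kappa) p))) (Plus (Var 4) p))).

Definition eq_expr x y := Minus (Num 1) (Plus (Minus x y) (Minus y x)).

Definition max_expr x y := Plus x (Minus y x).

(** Variable 10 is the column, 11 the row bound here, and [S] lists the variables holding excluded
    rows. The outer difference is 1 exactly when the cell is empty and the row is not excluded. *)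
Definition missing_expr (S : seq nat) :=
  Sum rows (Minus (Num 1)
    (foldr (fun u => Plus (eq_expr (Var 11) (Var u))) (cell 11 10) S)).

Definition null_bound_exprs :=
  let d := missing_expr in let col := Sum (Var 1) in let b := Var 3 in
  [:: Minus (col (Minus (Num 3) (d [::]))) (Plus b (Plus b b));
      Minus (col (Minus (Num 2) (d [:: 6]))) (Plus b b);
      Minus (col (Minus (Num 1) (d [:: 6; 7]))) b;
      Minus (col (max_expr (Minus (Num 2) (d [::]))
        (max_expr (Minus (Num 1) (d [:: 6; 7])) (Minus (Num 1) (d [:: 8; 9])))))
        (Plus b b)].

(** The formula of [rigidity_rankE]. In the range of the outer sum, which computes [#|E|], variables
    5 and 6 are a row and a column; in its body variable 5 is [s]. *)
Definition rank_expr :=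
  Sum (Sum rows (Sum (Var 1) (cell 5 6)))
    (Minus (Num 1) (Sum rows (Sum rows (Sum rows (Sum rows
      (foldr Plus (Num 0) [seq Minus c (Var 5) | c <- null_bound_exprs])))))).

Section Eval.
Variables (m n a b H : nat) (h : nat -> nat) (bit : nat -> nat -> bool).
Hypothesis h_bit : forall r q, r < a.+3 -> q < n ->
  let p := r * n + q in h (p - kappa + (p < kappa) * (H + p)) = bit r q.

Lemma eval_index env r q : 1 < size env ->
  eval h env (Plus (Sum (Var r) (Var 1)) (Var q))
  = nth 0 env r * nth 0 env 1 + nth 0 env q.
Proof.
move=> sz /=; under eq_bigr => v _ do rewrite nth_rcons sz.
by rewrite sum_nat_const card_ord.
Qed.

Lemma eval_cell env r q : 4 < size env -> nth 0 env 1 = n -> nth 0 env 4 = H ->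
  r < size env -> q < size env -> nth 0 env r < a.+3 -> nth 0 env q < n ->
  eval h env (cell r q) = bit (nth 0 env r) (nth 0 env q).
Proof.
move=> sz e1 e4 rs qs ra qn; rewrite -h_bit // -e1 -e4 /cell.
move PE: (Plus (Sum _ _) _) => P /=;
  rewrite -PE (eval_index r q (ltnW (ltnW (ltnW sz)))); set p := _ * _ + _.
have -> : 1 - (1 - (kappa - p)) = (p < kappa) by lia.
rewrite (eq_bigr (fun=> nth 0 env 4 + p)) ?sum_nat_const ?card_ord // => v _.
rewrite eval_index ?size_rcons; last by lia.
by rewrite !nth_rcons sz rs qs (ltnW (ltnW (ltnW sz))).
Qed.

Lemma eval_missing s i j k l q (S : seq nat) :
    q < n -> all (fun u => u < 11) S ->
  let env := [:: m; n; a; b; H; s; i; j; k; l; q] in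
  eval h env (missing_expr S) =
  #|[set r : 'I_a.+3 | ~~ bit r q] :\: [set r | val r \in [seq nth 0 env u | u <- S]]|.
Proof.
move=> qn S11 env; rewrite /= addn3 -sum1_card [RHS]big_mkcond /=.
apply: eq_bigr => r _; rewrite !inE.
set env' := [:: m, n, a, b, H, s, i, j, k, l, q & _].
have -> : eval h env' (foldr (fun u => Plus (eq_expr (Var 11) (Var u))) (cell 11 10) S)
    = count (fun u => nth 0 env u == r) S + bit r q.
  elim: S S11 => [_|u S IH]; first by rewrite [foldr _ _ _]/= eval_cell /= ?ltn_ord.
  rewrite [all _ _]/= => /andP[u11 S11]; rewrite [foldr _ _ _]/= [LHS]/=.
  rewrite IH // (_ : nth 0 env' u = nth 0 env u); last first.
    by rewrite /env' -[_ :: _]/(env ++ [:: val r]) nth_cat u11.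
  by rewrite addnA; congr (_ + _ + _); case: eqP; lia.
have -> : (val r \in [seq nth 0 env u | u <- S]) = (0 < count (fun u => nth 0 env u ==
  r) S).
  by rewrite -has_count; elim: (S) => //= u S' <-; rewrite inE eq_sym.
by case: (bit _ _); case: (count _ _).
Qed.

Lemma eval_foldr_plus env (L : seq expr) u :
  eval h env (foldr Plus (Num 0) [seq Minus c (Var u) | c <- L])
  = \sum_(c <- [seq eval h env c | c <- L]) (c - nth 0 env u).
Proof. by elim: L => [|c L IH] /=; rewrite ?big_nil // big_cons IH. Qed.

Lemma eval_null_bound_exprs s (i j k l : 'I_a.+3) :
  [seq eval h [:: m; n; a; b; H; s; val i; val j; val k;
    val l] c | c <- null_bound_exprs]
  = null_bound b (fun q : 'I_n => [set r : 'I_a.+3 | ~~ bit r q]) i j k l.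
Proof.
have d S q : q < n -> all (fun u => u < 11) S ->
    eval h (rcons [:: m; n; a; b; H; s; val i; val j; val k;
      val l] q) (missing_expr S) =
    #|[set r : 'I_a.+3 | ~~ bit r q] :\: [set r : 'I_a.+3 | val r \in
       [seq nth 0 (rcons [:: m; n; a; b; H; s; val i; val j; val k;
         val l] q) u | u <- S]]| :=
  @eval_missing s i j k l q S.
pose env0 := [:: m; n; a; b; H; s; val i; val j; val k; val l].
have set0E q : [set r : 'I_a.+3 | val r \in [seq nth 0 (rcons env0 q) u | u <- [::]]] =
  set0.
  by apply/setP => r; rewrite !inE.
have set1E q : [set r : 'I_a.+3 | val r \in [seq nth 0 (rcons env0 q) u | u <- [:: 6]]]
  = [set i].
  by apply/setP => r; rewrite !inE.
have set2E q : [set r : 'I_a.+3 | val r \in [seq nth 0 (rcons env0 q) u | u <- [:: 6;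
  7]]] = [set i; j].
  by apply/setP => r; rewrite !inE.
have set2E' q : [set r : 'I_a.+3 | val r \in [seq nth 0 (rcons env0 q) u | u <- [:: 8;
  9]]] = [set k; l].
  by apply/setP => r; rewrite !inE.
have evalSum env e f : eval h env (Sum e f) = \sum_(v < eval h env e) eval h (rcons env
  v) f by [].
have evalMinus env e f : eval h env (Minus e f) = eval h env e - eval h env f by [].
have evalMax env e f : eval h env (max_expr e f) = maxn (eval h env e) (eval h env f).
  by rewrite maxnE.
rewrite /null_bound_exprs /null_bound; congr [:: _; _; _; _];
  rewrite evalMinus evalSum; congr (_ - _); rewrite ?mulSn ?mul0n ?addn0 //;
  apply: eq_bigr => q _; rewrite ?evalMax !evalMinus !d ?ltn_ord //.
- by rewrite -/env0 set1E.
- by rewrite -/env0 set2E.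
- by rewrite -/env0 set0E set2E set2E'.
Qed.

Lemma eval_rank_expr : eval h [:: m; n; a; b; H] rank_expr =
  \sum_(s < \sum_(r < a.+3) \sum_(q < n) bit r q)
    (1 - \sum_(i < a.+3) \sum_(j < a.+3) \sum_(k < a.+3) \sum_(l < a.+3)
      \sum_(c <- null_bound b (fun q : 'I_n => [set r : 'I_a.+3 | ~~ bit r q]) i j k l)
        (c - s)).
Proof.
have evalSum env e f : eval h env (Sum e f) = \sum_(v < eval h env e) eval h (rcons env
  v) f by [].
have evalMinus1 env f : eval h env (Minus (Num 1) f) = 1 - eval h env f by [].
have evalRows env : eval h env rows = (nth 0 env 2).+3 by rewrite /= addn3.
have cardE : eval h [:: m; n; a; b; H] (Sum rows (Sum (Var 1) (cell 5 6)))
    = \sum_(r < a.+3) \sum_(q < n) bit r q.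
  rewrite evalSum evalRows; apply: eq_bigr => r _; rewrite evalSum;
    apply: eq_bigr => q _.
  by rewrite eval_cell /= ?ltn_ord.
rewrite /rank_expr evalSum cardE; apply: eq_bigr => s _.
rewrite evalMinus1; congr (1 - _).
rewrite evalSum evalRows; apply: eq_bigr => i _.
rewrite evalSum evalRows; apply: eq_bigr => j _.
rewrite evalSum evalRows; apply: eq_bigr => k _.
rewrite evalSum evalRows; apply: eq_bigr => l _.
by rewrite eval_foldr_plus -(eval_null_bound_exprs s i j k l).
Qed.

End Eval.
End RankProgram.

Lemma computes_of_runs (c : code) input s T T' :
  runs c (nth 0 input) s T -> T <= T' -> computes_within (c 0) input (s 0) T'.
Proof.
move=> r TT'; have [t tT] := r [::] [::]; rewrite cats0 cat0s add0n => e.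
have halt k : iter k (step (c 0)) (Config (size (c 0)) s) = Config (size (c 0)) s.
  by elim: k => //= k ->; rewrite /step onth_default.
rewrite /computes_within -(subnK (leq_trans tT TT')) iterD e halt.
by split; first exact: leqnn.
Qed.

Lemma nth_allpairs (S1 S2 : Type) (f : S1 -> S2 -> nat) x1 x2 s t r q : q < size t ->
  nth 0 [seq f x y | x <- s, y <- t] (r * size t + q)
  = if r < size s then f (nth x1 s r) (nth x2 t q) else 0.
Proof.
move=> qt; elim: s r => [|x s IH] r; first by rewrite /= nth_nil.
rewrite allpairs_cons nth_cat size_map; case: r => [|r].
  by rewrite mul0n add0n qt (nth_map x2).
by rewrite mulSn -addnA ltnNge leq_addr /= addKn IH.
Qed.

(** * The encoded input *)

Section Input.
Variables (m n a b : nat) (E : {set 'I_m * 'I_n}).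

(** Indices in [nat] make sense on the padding rows too, where the value is [false]. *)
Definition cell_bit (r q : nat) : bool :=
  [exists c in E, (val c.1 == r) && (val c.2 == q)].

Lemma cell_bitE (i : 'I_m) (q : 'I_n) : cell_bit i q = ((i, q) \in E).
Proof.
apply/existsP/idP => [[[i' q'] /andP[iE /andP[/= /eqP/val_inj ii /eqP/val_inj qq]]]|iE].
  by rewrite -ii -qq.
by exists (i, q); rewrite iE !eqxx.
Qed.

(** For [r >= m] the index lies beyond the input, where 0 is read, as it should be on empty rows. *)
Lemma nth_encode_input r q : q < n ->
  nth 0 (encode_input a b E) (4 + (r * n + q)) = cell_bit r q.
Proof.
move=> qn; rewrite /encode_input /=; have [rm|mr] := ltnP r m.
  have := @nth_allpairs _ _ (fun i j => nat_of_bool ((i, j) \in E)) (Ordinal rm)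
    (Ordinal qn)
    (enum 'I_m) (enum 'I_n) r q.
  rewrite !size_enum_ord => ->; rewrite // rm.
  have -> : nth (Ordinal rm) (enum 'I_m) r = Ordinal rm by apply: val_inj;
    rewrite /= nth_enum_ord.
  have -> : nth (Ordinal qn) (enum 'I_n) q = Ordinal qn by apply: val_inj;
    rewrite /= nth_enum_ord.
  by rewrite -cell_bitE.
rewrite nth_default.
  rewrite /cell_bit; case: existsP => // -[c /and3P[_ /eqP cr _]].
  by have := ltn_ord c.1; rewrite [X in X < _]cr ltnNge mr.
by rewrite size_allpairs !size_enum_ord add0n; apply: leq_trans (leq_addr _ _);
  rewrite leq_mul2r mr orbT.
Qed.

Lemma nth_encode_input_le1 p : 3 < p -> nth 0 (encode_input a b E) p <= 1.
Proof.
case: p => [|[|[|[|p]]]] // _; rewrite /encode_input /=.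
have [lt|ge] := ltnP p (size [seq nat_of_bool ((i, j) \in E) | i <- enum 'I_m,
  j <- enum 'I_n]).
  by have /allpairsP[[i j] [_ _ ->]] := mem_nth 0 lt; rewrite leq_b1.
by rewrite nth_default.
Qed.

Lemma missing_cell_bit (ma : m <= a.+3) q :
  missing ma E q = [set r : 'I_a.+3 | ~~ cell_bit r q].
Proof.
apply/setP => r; rewrite !inE; congr (~~ _).
apply/existsP/existsP => [[i /andP[/eqP <- iE]]|[[i q'] /and3P[iE /eqP ir /eqP/val_inj
  qq]]].
  by exists (i, q); rewrite iE !eqxx.
by exists i; rewrite -qq iE andbT; apply/eqP/val_inj; rewrite /= -ir.
Qed.

Lemma card_cell_bit : m <= a.+3 -> #|E| = \sum_(r < a.+3) \sum_(q < n) cell_bit r q.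
Proof.
move=> ma; transitivity (\sum_(i < m) \sum_(q < n) cell_bit i q).
  rewrite pair_bigA -sum1_card big_mkcond; apply: eq_bigr => -[i q] _ /=.
  by rewrite cell_bitE; case: (_ \in _).
rewrite (big_ord_widen _ (fun r => \sum_(q < n) nat_of_bool (cell_bit r q)) ma)
  big_mkcond.
apply: eq_bigr => r _; case: ltnP => // mr; rewrite big1 // => q _.
rewrite /cell_bit; case: existsP => // -[c /and3P[_ /eqP cr _]].
by have := ltn_ord c.1; rewrite [X in X < _]cr ltnNge mr.
Qed.

End Input.

(** * The complete program and its running time *)

Section RankCode.
Variables (tmp heap : nat).
Hypothesis tmp5 : 5 <= tmp.
Hypothesis tmp_heap : tmp.+2 < heap.

(** This is the product [(a + 3) n], which exceeds the index [r n + q] of every cell that is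
    read. *)
Definition offset_expr := Sum rows (Var 1).

Hypothesis offset_fits : fits tmp heap 4 tmp offset_expr.
Hypothesis rank_fits : fits tmp heap 5 tmp (rank_expr heap).

(** The offset becomes the fifth variable, in register 4; the input bit that was there is kept in
    [bs]. *)
Definition stash_code (bs : seq nat) : code :=
  seqc (compile heap 4 tmp offset_expr)
    (seqc (seqc (ins (Const 4 0)) (ins (Add 4 4 tmp))) (stash tmp heap 0 bs)).

Definition rank_code : code :=
  seqc (branch tmp stash_code [::] (heap - 4))
    (seqc (compile heap 5 tmp (rank_expr heap))
      (seqc (ins (Const 0 0)) (ins (Add 0 0 tmp)))).

(** The four inputs are at most [m + n], as [a <= m] and [b <= n], whence the copies of ['X]. Each
    relocated cell costs 3 steps for its branch and 4 for storing it; the constants 2 are for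
    copying the offset to register 4 and the result to register 0. *)
Definition rank_time : {poly nat} :=
  let benv := nseq 4 'X%R in
  (cost_bound benv offset_expr + (2 + 7 * (heap - 4))%N%:P
   + (cost_bound (rcons benv (eval_bound benv offset_expr)) (rank_expr heap) +
     2%N%:P))%R.

Lemma runs_rank_code m n a b (E : {set 'I_m * 'I_n}) : m <= a.+3 -> a <= m -> b <= n ->
  exists2 s, runs rank_code (nth 0 (encode_input a b E)) s (rank_time.[m + n]%R) &
    s 0 = \sum_(s < #|E|) (1 - \sum_(i < a.+3) \sum_(j < a.+3) \sum_(k < a.+3) \sum_(l
      < a.+3)
      \sum_(c <- null_bound b (fun q : 'I_n => [set r : 'I_a.+3 | ~~ cell_bit E r q]) i
        j k l) (c - s)).
Proof.
move=> ma am bn; pose kappa := heap - 4; pose s0 := nth 0 (encode_input a b E).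
pose env0 := [:: m; n; a; b]; pose H := a.+3 * n.
have s0le p : 3 < p -> s0 p <= 1 by exact: nth_encode_input_le1.
pose h0 p := s0 (heap + p).
have [|||s1 [r1 v1 fr1]] := @compileP tmp heap h0 offset_expr 4 tmp env0 s0 offset_fits
  erefl.
- by rewrite leqnn (leq_trans _ tmp5).
- by case=> [|[|[|[|i]]]].
- by [].
have evalH : eval h0 env0 offset_expr = H by rewrite /= sum_nat_const card_ord addn3.
pose s2 := upd (upd s1 4 0) 4 (upd s1 4 0 4 + upd s1 4 0 tmp).
have s24 : s2 4 = H by rewrite /s2 /upd !eqxx ifF ?v1 ?evalH //; lia.
pose bs := [seq s0 (4 + i) | i <- iota 0 kappa].
have szbs : size bs = kappa by rewrite size_map size_iota.
have [s3 [r3 v3 fr3]] := runs_stash tmp5 tmp_heap 0 bs s2.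
have [||s4 r4 s4P] := @runs_branch tmp stash_code kappa [::] s0 s3
  (cost h0 env0 offset_expr + (1 + 1 + 4 * size bs)).
- by move=> i _; apply: s0le.
- exact: (runs_seq r1 (runs_seq (runs_seq (runs_const _ _ _) (runs_add _ _ _ _)) r3)).
pose h p := s3 (heap + p).
(* In the final heap the cells below [H] are the original ones, the next [kappa] are the relocated
   ones, and all of them hold bits. *)
have hlow p : p < H -> h p = s0 (heap + p).
  move=> pH; rewrite /h fr3; last by rewrite s24; lia.
  by rewrite /s2 /upd !ifF ?fr1 //; lia.
have hmid p : p < kappa -> h (H + p) = s0 (4 + p).
  move=> pk; rewrite /h -[H]addn0 -{1}s24 v3 ?szbs //.
  by rewrite (nth_map 0) ?size_iota // nth_iota.
have hle p : h p <= 1.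
  have [pH|Hp] := ltnP p H; first by rewrite hlow // s0le; lia.
  have [pk|kp] := ltnP p (H + kappa).
    by rewrite -(subnKC Hp) hmid ?s0le; lia.
  rewrite /h fr3; last by rewrite s24 szbs; lia.
  by rewrite /s2 /upd !ifF ?fr1 ?s0le //; lia.
have hbit r q : r < a.+3 -> q < n ->
    let p := r * n + q in h (p - kappa + (p < kappa) * (H + p)) = cell_bit E r q.
  move=> ra qn p; rewrite -(nth_encode_input a b) // -/s0 -/p.
  have pH : p < H.
    by apply: leq_trans (_ : r.+1 * n <= H);
      [rewrite mulSn addnC /p ltn_add2l | rewrite leq_mul2r ra orbT].
  have [pk|kp] := ltnP p kappa.
    by rewrite (_ : p - kappa = 0) ?add0n ?mul1n ?hmid //; lia.
  by rewrite mul0n addn0 hlow; [congr s0; rewrite /kappa in kp *; lia | lia].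
pose env1 := [:: m; n; a; b; H].
have [|||s5 [r5 v5 fr5]] := @compileP tmp heap h (rank_expr heap) 5 tmp env1 s4
  rank_fits erefl.
- by rewrite leqnn tmp5.
- move=> i i5; rewrite s4P; last by lia.
  rewrite fr3; last by lia.
  move: i i5 => [|[|[|[|[|i]]]]] // _; rewrite ?s24 // /s2 /upd /= fr1 //.
- by move=> p; rewrite s4P //; lia.
pose s6 := upd (upd s5 0 0) 0 (upd s5 0 0 0 + upd s5 0 0 tmp).
have r6 := runs_seq r4 (runs_seq r5 (runs_seq (runs_const 0 0 s5) (runs_add 0 0 tmp
  (upd s5 0 0)))).
exists s6; last first.
  rewrite /s6 {1}/upd eqxx /upd eqxx ifF ?v5 ?add0n; last by lia.
  by rewrite (eval_rank_expr _ _ hbit) -card_cell_bit.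
apply: runs_le r6; rewrite szbs.
pose benv0 : seq {poly nat} := nseq 4 'X%R.
have le0 i : nth 0 env0 i <= (nth 0%R benv0 i).[m + n]%R.
  by case: i => [|[|[|[|i]]]]; rewrite /= ?hornerX ?nth_nil //; lia.
have h0le p : h0 p <= 1 by apply: s0le; lia.
have [e1 c1] := horner_le_bounds offset_expr h0le (erefl : size env0 = size benv0) le0.
have le1 i : nth 0 env1 i <= (nth 0%R (rcons benv0 (eval_bound benv0 offset_expr))
  i).[m + n]%R.
  rewrite -[env1]/(rcons env0 H) !nth_rcons; case: ltngtP => // _.
  by rewrite -evalH.
have [_ c2] := horner_le_bounds (rank_expr heap) hle
  (erefl : size env1 = size (rcons benv0 (eval_bound benv0 offset_expr))) le1.
have sumT (q1 q2 : {poly nat}) x y N : x <= q1.[N]%R -> y <= q2.[N]%R ->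
    x + (1 + 1 + 4 * kappa) + 3 * kappa + (y + (1 + 1))
    <= (q1 + (2 + 7 * kappa)%N%:P + (q2 + 2%N%:P)).[N]%R.
  move=> xq yq; rewrite !(hornerD, hornerC).
  by apply: leq_trans (leq_add (leq_add xq (leqnn (2 + 7 * kappa))) (leq_add yq (leqnn
    2))); lia.
exact: sumT c1 c2.
Qed.

End RankCode.

Theorem theorem1p2 :
  exists (P : program) (p : {poly nat}),
    forall (R : realType) (m n a b : nat) (E : {set 'I_m * 'I_n}),
      (a <= m)%N -> (b <= n)%N -> (m - a <= 3)%N ->
      computes_within P (encode_input a b E)
        (rigidity_rank R[i]%C a b E) (p.[(m + n)%N])%R.
Proof.
(* Registers 5 to 13 hold the bound variables, 14 to 39 the temporaries. *)
exists (rank_code 14 40 0), (rank_time 40) => R m n a b E am bn ma3.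
have ma : m <= a.+3 by lia.
have [s r s0] := @runs_rank_code 14 40 isT isT isT isT m n a b E ma am bn.
rewrite (rigidity_rankE _ ma) => [|p]; last exact: numField_infinite.
have -> : missing ma E = fun q : 'I_n => [set r : 'I_a.+3 | ~~ cell_bit E r q].
  by apply: boolp.funext => q; apply: missing_cell_bit.
by rewrite -s0; apply: computes_of_runs r _.
Qed.
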